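(* Let $\mathbf X$ be a nonnegative random vector in $\mathbb R^d$ with distribution $F\in(\mathcal D\cap\mathcal L)_{\mathscr R}$ and $\mathbf E[X_j]<\infty$ for every $j=1,\dots,d$. Let $\mathbf c>\mathbf 0$ and $\Theta\in(0,\infty)$, where $\mathbf c$, $\Theta$ and the integrated tail distribution $F_I$ are as described in the context. Then $F_I\in(\mathcal D\cap\mathcal L)_{\mathscr R}\subsetneq\mathcal S_{\mathscr R}$.
   Context: Notation. $d\in\mathbb N$; inequalities between vectors are componentwise; for a distribution $F$ and a Borel set $B$, $F(B)$ is the probability that a random vector with distribution $F$ lies in $B$. A set $B\subset\mathbb R^d$ is increasing if $\mathbf x\in B$, $\mathbf y\in[0,\infty)^d$ imply $\mathbf x+\mathbf y\in B$. Univariate classes. For a univariate distribution $V$ with tail $\overline V=1-V$ satisfying $\overline V(x)>0$ for all $x>0$: $V\in\mathcal S$ (subexponential, for $V$ on $[0,\infty)$) if $\lim_{x\to\infty}\overline{V^{n*}}(x)/\overline V(x)=n$ for every (equivalently, some) integer $n\ge2$, where $V^{n*}$ is the $n$-fold convolution; $V\in\mathcal L$ (long-tailed) if $\lim_{x\to\infty}\overline V(x-y)/\overline V(x)=1$ for every (equivalently, some) $y>0$; $V\in\mathcal D$ (dominatedly varying) if $\limsup_{x\to\infty}\overline V(bx)/\overline V(x)<\infty$ for every (equivalently, some) $b\in(0,1)$. Multivariate classes. $\mathscr R$ is the family of nonempty sets $A\subsetneq\mathbb R^d$ that are open, increasing, with $A^c$ convex and $\mathbf 0\notin\overline A$. For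 a distribution $F$ on $[0,\infty)^d$ and $A\in\mathscr R$, $F_A$ is the univariate distribution with tail $\overline F_A(x)=F(xA)$, $x>0$ (the distribution of $\sup\{u:\mathbf X\in uA\}$). For $\mathcal B\in\{\mathcal S,\ \mathcal D\cap\mathcal L\}$, $F\in\mathcal B_A$ means $F_A\in\mathcal B$, and $\mathcal B_{\mathscr R}=\bigcap_{A\in\mathscr R}\mathcal B_A$. Integrated tail. The vector $\mathbf c$ is $\mathbf c=\mathbf E[\theta]\,\mathbf p-\mathbf E[\mathbf X]$, where $\mathbf p\in(0,\infty)^d$ is a fixed premium vector and $\theta\ge0$ is a random variable (claim inter-arrival time) with $\mathbf E[\theta]<\infty$. For $A\in\mathscr R$, $$F_I(xA)=\frac1\Theta\int_0^\infty F(xA+v\,\mathbf c)\,dv,\qquad \Theta=\int_0^\infty F([0,\infty)^d+v\,\mathbf c)\,dv .$$ $F_I\in\mathcal B_A$ means that the univariate distribution $F_{I,A}$ with tail $\overline F_{I,A}(x)=F_I(xA)$, $x>0$, belongs to $\mathcal B$ (membership depends only on the tail for large $x$; where the formula exceeds 1 the tail is read as 1), and $F_I\in\mathcal B_{\mathscr R}$ means this holds for all $A\in\mathscr R$. *)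

(* Defs.v *)
From HB Require Import structures.
From mathcomp Require Import all_boot all_order all_algebra.
From mathcomp Require Import all_classical all_reals all_analysis.
From mathcomp Require Import measurable_realfun.

Set Implicit Arguments.
Unset Strict Implicit.
Unset Printing Implicit Defensive.

Import Order.TTheory GRing.Theory Num.Theory.
Import numFieldNormedType.Exports.

Local Open Scope classical_set_scope.
Local Open Scope ring_scope.

Section univariate_classes.
Variable R : realType.

(* The sum on R * R as a measurable function: the convolution of two laws is
   the law of the sum under their product. *)
Definition addR2 (z : R * R) : R := z.1 + z.2.

Lemma measurable_addR2 : measurable_fun [set: R * R] addR2.
Proof. exact: measurable_funD. Qed.

HB.instance Definition _ :=
  isMeasurableFun.Build _ _ _ _ addR2 measurable_addR2.

Definition convolution (V W : probability R R) : probability R R :=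
  distribution (V \x W)%E addR2.

Fixpoint conv_pow (V : probability R R) (n : nat) : probability R R :=
  if n is m.+1 then convolution (conv_pow V m) V else \d_(0 : R).

Definition tail (V : probability R R) (x : R) : R := fine (V `]x, +oo[%classic).

Definition subexponential : set (probability R R) :=
  [set V : probability R R | V `]-oo, 0[%classic = 0%E /\ (forall x, 0 < x -> 0 < tail V x) /\
    forall n : nat, (2 <= n)%N ->
      (fun x => tail (conv_pow V n) x / tail V x) @ +oo --> (n%:R : R)].

Definition long_tailed : set (probability R R) :=
  [set V : probability R R | (forall x, 0 < x -> 0 < tail V x) /\
    forall y : R, 0 < y ->
      (fun x => tail V (x - y) / tail V x) @ +oo --> (1 : R)].

Definition dominatedly_varying : set (probability R R) :=
  [set V : probability R R | (forall x, 0 < x -> 0 < tail V x) /\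
    forall b : R, 0 < b < 1 ->
      (limf_esup (fun x : R => (tail V (b * x) / tail V x)%:E) +oo%R
        < +oo)%E].

End univariate_classes.

Section multivariate_classes.
Variables (R : realType) (d : nat).

(* R^d with its Borel sigma-algebra. *)
Definition Rd := g_sigma_algebraType (@open 'rV[R]_d).

Definition orthant : set 'rV[R]_d := [set x | forall j, 0 <= x ord0 j].

Definition increasing_set (B : set 'rV[R]_d) : Prop :=
  forall x y, B x -> orthant y -> B (x + y).

Definition scale_set (a : R) (B : set 'rV[R]_d) : set 'rV[R]_d :=
  [set a *: x | x in B].

Definition translate_set (c : 'rV[R]_d) (B : set 'rV[R]_d) : set 'rV[R]_d :=
  [set x + c | x in B].

Definition ruin_sets : set (set 'rV[R]_d) :=
  [set A | [/\ A !=set0, A `<` setT, open A, increasing_set A &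
    convex_set (~` A : set (convex_lmodType 'rV[R]_d)) /\ ~ closure A 0]].

(* [radial_law G A V]: V is the univariate distribution on [0, oo[ with tail
   G (x A), x > 0, read as 1 where it exceeds 1. The argument G is a set
   function, not necessarily a measure, because the integrated tail below is
   given only by its values on the sets x A. *)
Definition radial_law (G : set 'rV[R]_d -> \bar R) (A : set 'rV[R]_d)
    (V : probability R R) : Prop :=
  V `]-oo, 0[%classic = 0%E /\
  forall x : R, 0 < x ->
    V `]x, +oo[%classic = Order.min 1%E (G (scale_set x A)).

Definition class_at (B : set (probability R R)) (A : set 'rV[R]_d) :
    set (set 'rV[R]_d -> \bar R) :=
  [set G | exists2 V, radial_law G A V & B V].

Definition class_ruin (B : set (probability R R)) :
    set (set 'rV[R]_d -> \bar R) :=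
  \bigcap_(A in ruin_sets) class_at B A.

Definition distr_class (B : set (probability R R)) : set (probability Rd R) :=
  [set F : probability Rd R | F orthant = 1%E /\ class_ruin B F].

Definition Theta (F : set 'rV[R]_d -> \bar R) (c : 'rV[R]_d) : \bar R :=
  (\int[lebesgue_measure]_(v in `[0%R, +oo[%classic)
     F (translate_set (v *: c) orthant))%E.

Definition integrated_tail (F : set 'rV[R]_d -> \bar R) (c : 'rV[R]_d)
    (B : set 'rV[R]_d) : \bar R :=
  (((fine (Theta F c))^-1)%:E *
    \int[lebesgue_measure]_(v in `[0%R, +oo[%classic)
      F (translate_set (v *: c) B))%E.

Definition coordinate {T : Type} (X : T -> 'rV[R]_d) (j : 'I_d) (w : T) : R :=
  X w ord0 j.

Definition net_drift {disp : measure_display} {T : measurableType disp}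
    (P : probability T R) (X : T -> 'rV[R]_d) (theta : T -> R)
    (p : 'rV[R]_d) : 'rV[R]_d :=
  \row_j (fine ('E_P[theta])%E * p ord0 j - fine ('E_P[coordinate X j])%E).

End multivariate_classes.

(* Main.v *)
Require Import Defs.
From HB Require Import structures.
From mathcomp Require Import all_boot all_order all_algebra.
From mathcomp Require Import all_classical all_reals all_analysis.
From mathcomp Require Import measurable_realfun ring lra.

Set Implicit Arguments.
Unset Strict Implicit.
Unset Printing Implicit Defensive.

Import Order.TTheory GRing.Theory Num.Theory.
Import numFieldNormedType.Exports.

Local Open Scope classical_set_scope.
Local Open Scope ring_scope.

(** Two facts are to be proved: the integrated tail stays in D and L along every
    ruin set, and D and L together are strictly smaller than S on the orthant.

    Put [g x = \int_0^oo P (X \in xA + vc) dv], so that the tail of the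
    integrated law along [A] is [g x / Theta] for large [x]. By Tonelli, [g x] is
    the mean length of the set of times [v >= 0] with [X - vc \in xA]. The
    complement of [A] is convex, so the pairs (level, time) at which a given
    claim vector is harmless form a convex set; the exit time is therefore
    convex in the level, and so is its mean [g] ([ruin_region_convex]).
    Convexity makes [g] continuous and bounds its slope by [2 g (x / 2) / x]
    ([ruin_mass_slope]). Hence dominated variation of [g] already gives
    long-tailedness: [g (x - y) - g x] is at most of order [g x * y / x]
    ([dominatedly_varying_long_tailed_of_slope]).

    Dominated variation of [g] is inherited from that of the tail [h] of [X]
    along [A], by comparing integrands. For constants [K] and [k] depending on
    [A] and [c] only,
      [h (x + K v) <= P (X \in xA + vc) <= h (max x (k v))].
    The lower bound is convexity of the complement of [A] again
    ([ruinous_of_higher_level]). The upper bound uses that [X >= 0]: the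
    coordinates of [X] that survive the drift exceed those of [v c], and [X]
    restricted to them still lies in [xA] ([ruinous_drift_level]). Since
    [x + K v] is at most a constant times [max (b x) (k v)], dominated variation
    of [h] bounds one integrand by a constant times the other
    ([ruin_mass_dominated]). Finiteness of [g] and its decay to 0 come from the
    finite means of the coordinates of [X].

    For the second fact, a long-tailed law is subexponential as soon as two
    moderately large summands are unlikely to add up to a large value. The
    condition [big_jump_tail] expresses this with a truncation level [s x], and
    a union bound over rectangles under the product law turns it into
    subexponentiality ([subexponential_of_big_jump]). With [s x = x / 2] it
    covers D and L. With [s x = sqrt x] it covers the tail
    [exp (- ln (1 + x) ^ 2)], which is not dominatedly varying. The law of [(Z, ..., Z)], with [Z] having that tail,
    meets every ruin set along a ray, so that its radial laws are rescalings of
    the law of [Z]; it separates the two classes. *)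

(** * Tails of univariate laws and of their convolutions *)

Section tails.
Variable R : realType.
Implicit Types (V W : probability R R) (x k s : R).

Lemma tailE V x : V `]x, +oo[%classic = (tail V x)%:E.
Proof. by rewrite /tail fineK// fin_num_measure. Qed.

Lemma tail_ge0 V x : 0 <= tail V x.
Proof. by rewrite fine_ge0. Qed.

Lemma tail_nonincreasing V : {homo tail V : x y / x <= y >-> y <= x}.
Proof.
move=> x y xy; rewrite -lee_fin -!tailE le_measure ?inE//.
exact: subitvPl.
Qed.

Let idR : R -> R := idfun.

#[local] HB.instance Definition _ :=
  @isMeasurableFun.Build _ _ _ _ idR (@measurable_id _ _ setT).

Lemma tail_cvg0 V : tail V x @[x --> +oo] --> 0.
Proof.
have := cvg_ccdfy0 (idR : {RV V >-> R}).
move=> /fine_cvg; apply: cvg_trans; apply: near_eq_cvg.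
by near=> x => /=; rewrite /ccdf /distribution /pushforward /= preimage_id.
Unshelve. all: by end_near. Qed.

Lemma nonneg_law_ge0 V : V `]-oo, 0[%classic = 0%E ->
  V `[0, +oo[%classic = 1%E.
Proof.
move=> V0; have := probability_setC V (measurable_itv `]-oo, (0:R)[).
by rewrite V0 sube0 setCitvl.
Qed.

Lemma nonneg_law_itv V x : V `]-oo, 0[%classic = 0%E -> 0 <= x ->
  V `[0, x]%classic = (1 - tail V x)%:E.
Proof.
move=> V0 x0.
have : (V [set: R] = V `]-oo, 0%R[%classic + V `[0%R, x]%classic +
    V `]x, +oo[%classic)%E.
  rewrite -measureU//; last first.
    by apply/seteqP; split => y //=; rewrite !in_itv/= => -[]; lra.
  rewrite -measureU//; [|exact: measurableU|]; last first.
    by apply/seteqP; split => y //=; rewrite !in_itv/= => -[[]]; lra.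
  congr (V _); apply/seteqP; split => y //= _; rewrite !in_itv/= andbT.
  have [?|?] := ltP y 0; first by do 2 left.
  by have [?|?] := ltP x y; [right|left; right].
rewrite probability_setT V0 add0e tailE => /eqP; rewrite eq_sym.
have fV : V `[0%R, x]%classic \is a fin_num by rewrite fin_num_measure.
rewrite -(fineK fV) -EFinD => /eqP[] <-.
by congr (_%:E); lra.
Qed.

(** A sum of nonnegative terms exceeds [x] as soon as one of them does; the two
    disjoint events below are that the first does, and that only the second
    does. *)
Lemma tail_convolution_ge W V x :
  W `]-oo, 0[%classic = 0%E -> V `]-oo, 0[%classic = 0%E -> 0 <= x ->
  tail W x + (1 - tail W x) * tail V x <= tail (convolution W V) x.
Proof.
move=> W0 V0 x0; rewrite -lee_fin -tailE EFinD EFinM -nonneg_law_itv// -!tailE.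
rewrite -[W `]x, +oo[%classic]mule1 -(nonneg_law_ge0 V0) -!product_measure1E// -measureU//=.
- rewrite /convolution /distribution /pushforward le_measure ?inE//=.
  + by apply: measurableU; exact: measurableX.
  + rewrite -[X in measurable X]setTI; exact: measurable_addR2.
  + by move=> [w z] /= []; rewrite /addR2/= !in_itv/= => -[]; lra.
- exact: measurableX.
- exact: measurableX.
- by apply/seteqP; split => -[w z] //=; rewrite !in_itv/= => -[[] + _ [] + _]; lra.
Qed.

Lemma convolution_ge0 W V :
  W `]-oo, 0[%classic = 0%E -> V `]-oo, 0[%classic = 0%E ->
  convolution W V `]-oo, 0[%classic = 0%E.
Proof.
move=> W0 V0; apply/eqP; rewrite -measure_le0.
have : ((W \x V) ((`]-oo, 0%R[ `*` setT) `|` (setT `*` `]-oo, 0%R[)) <= 0 :> \bar R)%E.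
  apply: le_trans (measureU2 _ _ _) _; try exact: measurableX.
  by rewrite /= !product_measure1E//= W0 V0 mul0e mule0 adde0.
apply: le_trans; rewrite /= /pushforward/=.
apply: le_measure; rewrite ?inE.
- rewrite -[X in measurable X]setTI; exact: measurable_addR2.
- by apply: measurableU; exact: measurableX.
- move=> [w z] /=; rewrite /addR2/= !in_itv/= => wz.
  by have [?|?] := ltP w 0; [left|right; split=> //; lra].
Qed.

Lemma conv_pow_ge0 V n : V `]-oo, 0[%classic = 0%E ->
  conv_pow V n `]-oo, 0[%classic = 0%E.
Proof.
move=> V0; elim: n => [|n IH]/=; last exact: convolution_ge0.
by rewrite diracE/= memNset//= in_itv/= ltxx.
Qed.

(** A sum can exceed [x] only if one summand exceeds [x - k], or both exceed [k]
    and then the larger one exceeds [x / 2] while the smaller one either exceeds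
    [s] or leaves more than [x - s] to the other. All these events are
    rectangles, so that no integration is needed. *)
Lemma tail_convolution_le W V x k s : tail (convolution W V) x <=
  tail W (x - k) + tail V (x - k) +
  (tail W k * tail V (x - s) + tail W (x - s) * tail V k +
   (tail W s * tail V (x / 2) + tail W (x / 2) * tail V s)).
Proof.
pose M := (W \x V)%E.
have ME A B : measurable A -> measurable B -> M (A `*` B) = (W A * V B)%E.
  exact: product_measure1E.
have mI a b : measurable (`]a, +oo[ `*` `]b, +oo[ : set (R * R)).
  exact: measurableX.
pose E := ((`]x - k, +oo[ `*` setT) `|` (setT `*` `]x - k, +oo[)) `|`
  (((`]k, +oo[ `*` `]x - s, +oo[) `|` (`]x - s, +oo[ `*` `]k, +oo[)) `|`
  ((`]s, +oo[ `*` `]x / 2, +oo[) `|` (`]x / 2, +oo[ `*` `]s, +oo[))) : set (R * R).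
have m1 : measurable (`]x - k, +oo[ `*` setT : set (R * R)) by exact: measurableX.
have m2 : measurable (setT `*` `]x - k, +oo[ : set (R * R)) by exact: measurableX.
have le : (convolution W V `]x, +oo[%classic <= M E)%E.
  apply: (@le_measure _ _ _ (W \x V)%E); rewrite ?inE.
  - rewrite -[X in measurable X]setTI; exact: measurable_addR2.
  - by do ![apply: measurableU => //].
  - move=> [w z]; rewrite /= /addR2 /= !in_itv/= !andbT /E => wz.
    rewrite /setU /setX /= !in_itv/= !andbT.
    have [?|wk] := ltP (x - k) w; first by left; left.
    have [?|zk] := ltP (x - k) z; first by left; right.
    have [?|hz] := ltP (x / 2) z.
      have [?|ws] := ltP s w; first by right; right; left.
      by right; left; left; split; lra.
    have [?|zs] := ltP s z; first by right; right; right; split => //; lra.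
    by right; left; right; split; lra.
have U2 A B : measurable A -> measurable B -> (M (A `|` B) <= M A + M B)%E.
  exact: measureU2.
rewrite -lee_fin -tailE; apply: (le_trans le); rewrite /E.
apply: le_trans (U2 _ _ _ _) _; try by do ![apply: measurableU => //].
rewrite EFinD; apply: leeD.
  apply: le_trans (U2 _ _ _ _) _ => //.
  by rewrite !ME// !probability_setT mule1 mul1e !tailE.
apply: le_trans (U2 _ _ _ _) _; try by do ![apply: measurableU => //].
rewrite EFinD; apply: leeD; (apply: le_trans (U2 _ _ _ _) _ => //).
  by rewrite !ME// !tailE.
by rewrite !ME// !tailE.
Qed.

End tails.

(** * A sufficient condition for subexponentiality *)

Section tail_conditions.
Variable R : realType.
Implicit Types (V W : probability R R) (T : R -> R).

(** Dominated variation as an inequality between tails, free of the upper limit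
    and of division. *)
Lemma near_tail_ratio_bounded T (b : R) : (forall x : R, 0 < x -> 0 < T x) ->
  (limf_esup (fun x : R => (T (b * x) / T x)%:E) +oo%R < +oo)%E <->
  exists C, \forall x \near +oo, T (b * x) <= C * T x.
Proof.
move=> T0; split.
  move=> /ereal_inf_lt[_ [S S0 <-]] supS.
  have [C SC] : exists C : R, forall x, S x -> T (b * x) / T x <= C.
    move: supS; case E : (ereal_sup _) => [C||]// _.
      exists C => x Sx; rewrite -lee_fin -E.
      by apply: ereal_sup_ubound; exists x.
    exists 0 => x Sx; suff : ((T (b * x) / T x)%:E <= -oo)%E by [].
    by rewrite -E; apply: ereal_sup_ubound; exists x.
  exists C; near=> x.
  have x0 : 0 < T x by apply: T0; near: x; exact: nbhs_pinfty_gt.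
  by rewrite -ler_pdivrMr//; apply: SC; near: x.
move=> [C TC]; apply: (@le_lt_trans _ _ C%:E); last by rewrite ltry.
apply: ge_ereal_inf.
exists (ereal_sup ((fun x => (T (b * x) / T x)%:E) @`
    [set x | 0 < x /\ T (b * x) <= C * T x])).
- exists [set x | 0 < x /\ T (b * x) <= C * T x] => //.
  near=> x; split; near: x; first exact: nbhs_pinfty_gt.
  exact: TC.
- apply: ge_ereal_sup => _ [x [x0 xC] <-].
by rewrite lee_fin ler_pdivrMr// T0.
Unshelve. all: by end_near. Qed.

Definition long_tail T := forall y : R, 0 < y ->
  T (x - y) / T x @[x --> +oo] --> (1 : R).

(** [s x] separates a small summand from a large one: when one summand stays
    below [s x], the other one exceeds [x - s x], which costs a constant factor
    over exceeding [x]; when it does not, the other one exceeds [x / 2], and the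
    product of the two probabilities is negligible. *)
Definition big_jump_tail T := exists s : R -> R, [/\ s x @[x --> +oo] --> +oo,
  (\forall x \near +oo, s x <= x / 2),
  (exists C, \forall x \near +oo, T (x - s x) <= C * T x) &
  T (s x) * T (x / 2) / T x @[x --> +oo] --> 0].

Lemma cvg_pinfty_ge (f g : R -> R) : (\forall x \near +oo, f x <= g x) ->
  f x @[x --> +oo] --> +oo -> g x @[x --> +oo] --> +oo.
Proof.
move=> fg /cvgryPge cf; apply/cvgryPge => A.
near=> x; apply: (@le_trans _ _ (f x)); near: x => //; exact: cf.
Unshelve. all: by end_near. Qed.

Lemma cvg_pinfty_subr (y : R) : x - y @[x --> +oo] --> +oo.
Proof. exact: cvg_addrr. Qed.

Lemma cvg_pinfty_mull (a : R) : 0 < a -> a * x @[x --> +oo] --> +oo.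
Proof.
move=> a0; apply/cvgryPge => A.
near=> x; rewrite mulrC -ler_pdivrMr//.
Unshelve. all: by end_near. Qed.

Lemma long_tail_scale T T' (a : R) : 0 < a -> 
  (\forall x \near +oo, T' x = T (a * x)) -> long_tail T -> long_tail T'.
Proof.
move=> a0 TT' lT y y0.
have : T (a * x - a * y) / T (a * x) @[x --> +oo] --> (1 : R).
  apply: (@cvg_comp _ _ _ (fun x => a * x) (fun x => T (x - a * y) / T x)).
    exact: cvg_pinfty_mull.
  by apply: lT; rewrite mulr_gt0.
apply: cvg_trans; apply: near_eq_cvg; near=> x.
congr (_ / _); first rewrite -mulrBr.
  by apply/esym; near: x; exact: (@cvg_pinfty_subr y _ TT').
by apply/esym; near: x.
Unshelve. all: by end_near. Qed.

Lemma big_jump_tail_scale T T' (a : R) : 0 < a ->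
  (\forall x \near +oo, T' x = T (a * x)) -> big_jump_tail T -> big_jump_tail T'.
Proof.
move=> a0 TT' [s [sy s2 [C TC] T0]].
have ay := cvg_pinfty_mull a0.
have an : a != 0 by rewrite gt_eqF.
pose r x := s (a * x) / a.
have say : s (a * x) @[x --> +oo] --> +oo by apply: cvg_comp ay sy.
have ry : r x @[x --> +oo] --> +oo.
  rewrite /r; under eq_fun do rewrite mulrC.
  apply: (cvg_comp _ _ say); apply: cvg_pinfty_mull; by rewrite invr_gt0.
have r2 : \forall x \near +oo, r x <= x / 2.
  near=> x; rewrite /r ler_pdivrMr//.
  have -> : x / 2 * a = a * x / 2 by ring.
  by near: x; exact: (ay _ s2).
have ar x : a * r x = s (a * x) by rewrite /r mulrC divfK.
have xr : x - r x @[x --> +oo] --> +oo.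
  have := @cvg_pinfty_mull (2^-1) ltac:(by []).
  apply: cvg_pinfty_ge; near=> x.
  have : r x <= x / 2 by near: x.
  lra.
exists r; split => //.
  exists C; near=> x.
  have -> : T' (x - r x) = T (a * x - s (a * x)).
    rewrite -ar -mulrBr; near: x; exact: (xr _ TT').
  have -> : T' x = T (a * x) by near: x.
  near: x; exact: (ay _ TC).
have := cvg_comp _ _ ay T0.
apply: cvg_trans; apply: near_eq_cvg; near=> x => /=.
have -> : T' x = T (a * x) by near: x.
have -> : T' (r x) = T (s (a * x)) by rewrite -ar; near: x; exact: (ry _ TT').
have -> // : T' (x / 2) = T (a * x / 2).
rewrite -mulrA; near: x.
have := @cvg_pinfty_mull (2^-1) ltac:(by []).
under eq_fun do rewrite mulrC.
by move=> /(_ _ TT').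
Unshelve. all: by end_near. Qed.

(** Induction on the number of summands: if [W] is the law of a sum of [n] of
    them and its tail is equivalent to [n] times that of [V], the two bounds on
    the tail of the convolution of [W] and [V] squeeze its ratio to that of [V]
    to [n + 1]. The terms of the upper bound in which both summands exceed [k]
    are at most a multiple of the tail of [V] at [k], so [k] is fixed large
    first, and long-tailedness handles the shift by [k]. *)
Lemma subexponential_of_big_jump V : V `]-oo, 0[%classic = 0%E ->
  (forall x : R, 0 < x -> 0 < tail V x) -> long_tail (tail V) ->
  big_jump_tail (tail V) -> subexponential V.
Proof.
move=> V0 T0 lT [s [sy s2 [C TC] sT]]; split => //; split => // n _.
elim: n => [|n IH].
  apply: cvg_near_cst; near=> x.
  have x0 : 0 < x by near: x; exact: nbhs_pinfty_gt.
  have -> : tail (conv_pow V 0) x = 0; last by rewrite mul0r.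
  rewrite /tail /= /dirac indicE memNset//= in_itv/= andbT.
  by apply/negP; rewrite -leNgt ltW.
pose W := conv_pow V n; pose T := tail V; rewrite -/W -/T in IH lT TC sT *.
have W0 : W `]-oo, 0[%classic = 0%E by exact: conv_pow_ge0.
pose K : R := n.+1%:R.
have K0 : 0 < K by rewrite ltr0n.
have [N [_ NP]] : \forall y \near +oo, tail W y <= K * T y.
  move/cvgrPdist_le : IH => /(_ 1 ltr01) IH.
  near=> y.
  have y0 : 0 < T y by apply: T0; near: y; exact: nbhs_pinfty_gt.
  have : `|n%:R - tail W y / T y| <= 1 by near: y.
  rewrite ler_distlC => /andP[_].
  by rewrite ler_pdivrMr// /K -natr1.
apply/cvgrPdist_le => /= e e0.
have tV := @tail_cvg0 _ V; have tW := @tail_cvg0 _ W.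
(* makes the two terms containing [T k] at most [e / 8 * T x] each *)
pose eta : R := e / 4 / (2 * K * (`|C| + 1)).
have C1 : 0 < `|C| + 1 by rewrite ltr_wpDl.
have eta0 : 0 < eta by rewrite !divr_gt0// !mulr_gt0.
move/cvgr0Pnorm_le : tV => /(_ _ eta0) tV.
have [k [k0 kN kT]] : exists k, [/\ 0 < k, N < k & T k <= eta].
  near (pinfty_nbhs R) => k; exists k; split.
  - by near: k; apply: nbhs_pinfty_gt; exact: num_real.
  - by near: k; apply: nbhs_pinfty_gt; exact: num_real.
  - by apply: (le_trans (ler_norm _)); near: k.
have e4 : 0 < e / 4 by rewrite divr_gt0.
have lk := lT k k0.
have IHk : tail W (x - k) / T x @[x --> +oo] --> (n%:R : R).
  have : tail W (x - k) / T (x - k) * (T (x - k) / T x) @[x --> +oo] --> (n%:R : R).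
    rewrite -[X in _ --> X]mulr1; apply: cvgM lk.
    exact: (cvg_comp _ _ (@cvg_pinfty_subr k) IH).
  apply: cvg_trans; apply: near_eq_cvg; near=> x => /=.
  have xk : 0 < T (x - k).
    by apply: T0; rewrite subr_gt0; near: x; apply: nbhs_pinfty_gt; exact: num_real.
  by rewrite mulrA divfK// gt_eqF.
move/cvgrPdist_le : IHk => /(_ _ e4) IHk.
move/cvgrPdist_le : lk => /(_ _ e4) lk.
move/cvgrPdist_le : IH => /(_ (e / 2) ltac:(lra)) IH.
move/cvgr0Pnorm_le : tW => /(_ (e / 2) ltac:(lra)) tW.
move/cvgr0Pnorm_le : sT => /(_ (e / 4 / (2 * K)) ltac:(by rewrite divr_gt0// mulr_gt0)) sT.
near=> x.
have x0 : 0 < x by near: x; exact: nbhs_pinfty_gt.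
have Tx := T0 _ x0.
rewrite ler_distlC /= -/W -/T; apply/andP; split.
  rewrite ler_pdivlMr//; apply: le_trans (tail_convolution_ge W0 V0 (ltW x0)).
  have : `|n%:R - tail W x / T x| <= e / 2 by near: x.
  rewrite ler_distlC => /andP[+ _]; rewrite ler_pdivlMr// => h1.
  have : `|tail W x| <= e / 2 by near: x.
  rewrite ger0_norm ?tail_ge0// => h2.
  have h3 : tail W x * T x <= e / 2 * T x by rewrite ler_wpM2r ?tail_ge0.
  rewrite -natr1 -/T; lra.
rewrite ler_pdivrMr//; apply: le_trans (tail_convolution_le W V x k (s x)) _.
rewrite -/T.
have sN : N < s x by near: x; apply: (sy (fun y => N < y)); apply: nbhs_pinfty_gt; exact: num_real.
have sx2 : s x <= x / 2 by near: x.
have h1 : tail W (x - k) <= (n%:R + e / 4) * T x.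
  have : `|n%:R - tail W (x - k) / T x| <= e / 4 by near: x.
  by rewrite ler_distlC => /andP[_]; rewrite ler_pdivrMr.
have h2 : T (x - k) <= (1 + e / 4) * T x.
  have : `|1 - T (x - k) / T x| <= e / 4 by near: x.
  by rewrite ler_distlC => /andP[_]; rewrite ler_pdivrMr.
have hs : T (x - s x) <= (`|C| + 1) * T x.
  apply: (@le_trans _ _ (C * T x)); first by near: x.
  by rewrite ler_wpM2r ?tail_ge0// (le_trans (ler_norm _))// lerDl.
have TT0 y : 0 <= T y := tail_ge0 _ _.
have h3 : tail W k * T (x - s x) <= K * eta * ((`|C| + 1) * T x).
  apply: ler_pM => //; rewrite ?tail_ge0//.
  apply: (le_trans (NP _ kN)); rewrite ler_pM2l//.
have h4 : tail W (x - s x) * T k <= K * ((`|C| + 1) * T x) * eta.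
  apply: ler_pM => //; rewrite ?tail_ge0//.
  apply: (le_trans (NP _ _)); first lra.
  by rewrite ler_pM2l.
have hq : T (s x) * T (x / 2) <= e / 4 / (2 * K) * T x.
  rewrite -ler_pdivrMr//.
  by apply: (le_trans (ler_norm _)); near: x.
have h5 : tail W (s x) * T (x / 2) <= K * (T (s x) * T (x / 2)).
  by rewrite mulrA ler_wpM2r// NP.
have h6 : tail W (x / 2) * T (s x) <= K * (T (s x) * T (x / 2)).
  by rewrite (mulrC (T (s x))) mulrA ler_wpM2r// NP//; lra.
have h34 : K * eta * ((`|C| + 1) * T x) = e / 8 * T x.
  by rewrite /eta; field; rewrite !gt_eqF//; lra.
have h34' : K * ((`|C| + 1) * T x) * eta = e / 8 * T x.
  by rewrite -h34; ring.
have h56 : K * (e / 4 / (2 * K) * T x) = e / 8 * T x by field; rewrite gt_eqF.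
have h57 : K * (T (s x) * T (x / 2)) <= e / 8 * T x.
  by rewrite -h56 ler_pM2l.
rewrite -natr1; lra.
Unshelve. all: by end_near. Qed.

(** The truncation at half: dominated variation makes the tail at [x / 2]
    comparable to the tail at [x], and then its square is negligible. *)
Theorem dominatedly_varying_long_tailed_subexponential V :
  V `]-oo, 0[%classic = 0%E -> dominatedly_varying V -> long_tailed V ->
  subexponential V.
Proof.
move=> V0 [T0 dV] [_ lV]; apply: subexponential_of_big_jump => //.
have half : 0 < (2^-1 : R) < 1 by lra.
have [C TC] := (near_tail_ratio_bounded _ T0).1 (dV _ half).
have hy : (x : R) / 2 @[x --> +oo] --> +oo.
  by under eq_fun do rewrite mulrC; exact: cvg_pinfty_mull.
exists (fun x => x / 2); split => //.
- by near=> x.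
- exists C; near=> x.
  have -> : x - x / 2 = 2^-1 * x by lra.
  by near: x.
apply: (@squeeze_cvgr _ _ _ _ (fun=> 0) (fun x => C * tail V (x / 2))).
- near=> x.
  have x0 : 0 < tail V x by apply: T0; near: x; exact: nbhs_pinfty_gt.
  have xC : tail V (x / 2) <= C * tail V x.
    by rewrite (mulrC x); near: x.
  apply/andP; split; first by rewrite divr_ge0 ?mulr_ge0 ?tail_ge0.
  rewrite ler_pdivrMr// -mulrA (mulrC (tail V (x / 2)) (tail V x)) mulrA.
  by rewrite ler_wpM2r ?tail_ge0.
- exact: cvg_cst.
- rewrite -[X in _ --> X](mulr0 C); apply: cvgMr.
  exact: (cvg_comp _ _ hy (@tail_cvg0 _ V)).
Unshelve. all: by end_near. Qed.

End tail_conditions.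

(** * Laws with a prescribed tail *)

Section law_of_tail.
Variables (R : realType) (T : R -> R).
Hypothesis T01 : forall x : R, 0 < x -> 0 <= T x <= 1.
Hypothesis T_nonincreasing : forall x y : R, 0 < x -> x <= y -> T y <= T x.
Hypothesis T_right_continuous : forall x : R, 0 < x -> T @ x^'+ --> T x.
Hypothesis T_cvg0 : T x @[x --> +oo] --> 0.

(** The law puts at 0 the mass that [T] leaves unaccounted for, namely
    [1 - atom0], where [atom0] is the limit of [T] at 0 from the right. *)
Let atom0 : R := sup [set T x | x in `]0, +oo[%classic].

Let cdf_of_tail (x : R) : R :=
  if x < 0 then 0 else if x == 0 then 1 - atom0 else 1 - T x.

Let cdf_gt0 x : 0 < x -> cdf_of_tail x = 1 - T x.
Proof. by move=> x0; rewrite /cdf_of_tail ltNge ltW//= gt_eqF. Qed.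

Let T_ubound : has_ubound [set T x | x in `]0, +oo[%classic].
Proof.
by exists 1 => _ [x /= + <-]; rewrite in_itv/= andbT => /T01/andP[].
Qed.

Let T_le_atom0 x : 0 < x -> T x <= atom0.
Proof.
move=> x0; apply: ub_le_sup; first exact: T_ubound.
by exists x => //=; rewrite in_itv/= x0.
Qed.

Let atom0_le1 : atom0 <= 1.
Proof.
apply: ge_sup; first by exists (T 1), 1 => //=; rewrite in_itv/= ltr01.
by move=> _ [x /= + <-]; rewrite in_itv/= andbT => /T01/andP[].
Qed.

Let cdf_nondecreasing : nondecreasing cdf_of_tail.
Proof.
move=> x y xy; rewrite /cdf_of_tail.
have [x0|x0] := ltP x 0.
  case: ifPn => // y0; case: ifPn => y1; first by rewrite subr_ge0 atom0_le1.
  have y2 : 0 < y by rewrite lt_neqAle eq_sym y1 leNgt.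
  by rewrite subr_ge0; case/andP: (T01 y2).
rewrite ltNge (le_trans x0 xy)/=.
have [x1|x1] := eqVneq x 0.
  case: eqVneq => // y1; rewrite lerB//.
  by apply: T_le_atom0; rewrite lt_neqAle eq_sym y1 (le_trans x0 xy).
have x2 : 0 < x by rewrite lt_neqAle eq_sym x1 x0.
by rewrite gt_eqF ?(lt_le_trans x2)// lerB// T_nonincreasing.
Qed.

Let cdf_right_continuous : right_continuous cdf_of_tail.
Proof.
move=> x; have [x0|x0|->] := ltgtP x 0.
- apply: cvg_near_cst; near=> y.
  have y0 : y < 0 by near: y; exact: nbhs_right_lt.
  by rewrite /cdf_of_tail x0 y0.
- rewrite cdf_gt0//.
  have : 1 - T y @[y --> x^'+] --> 1 - T x.
    by apply: cvgB; [exact: cvg_cst|exact: T_right_continuous].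
  apply: cvg_trans; apply: near_eq_cvg; near=> y.
  rewrite cdf_gt0//; apply: (lt_trans x0); near: y; exact: nbhs_right_gt.
- have -> : cdf_of_tail 0 = 1 - atom0 by rewrite /cdf_of_tail ltxx eqxx.
  have : 1 - T y @[y --> 0^'+] --> 1 - atom0.
    apply: cvgB; first exact: cvg_cst.
    apply: (@nonincreasing_at_right_cvgr R T 0 +oo%O) => //.
    by move=> y z; rewrite !in_itv/= !andbT => y0 z0 yz; exact: T_nonincreasing.
  apply: cvg_trans; apply: near_eq_cvg; near=> y.
  by rewrite cdf_gt0//; near: y; exact: nbhs_right_gt.
Unshelve. all: by end_near. Qed.

Let cdf_cvgNy : cdf_of_tail @ -oo --> (0 : R).
Proof.
apply: cvg_near_cst; near=> x.
have x0 : x < 0 by near: x; exact: nbhs_ninfty_lt.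
by rewrite /cdf_of_tail x0.
Unshelve. all: by end_near. Qed.

Let cdf_cvgy : cdf_of_tail @ +oo --> (1 : R).
Proof.
have : 1 - T y @[y --> +oo] --> (1 : R).
  by rewrite -[X in _ --> X]subr0; apply: cvgB; first exact: cvg_cst.
apply: cvg_trans; apply: near_eq_cvg; near=> y.
by rewrite cdf_gt0//; near: y; exact: nbhs_pinfty_gt.
Unshelve. all: by end_near. Qed.

HB.instance Definition _ := isCumulative.Build R _ R cdf_of_tail
  cdf_nondecreasing cdf_right_continuous.

HB.instance Definition _ := isCumulativeBounded.Build R 0 1 cdf_of_tail
  cdf_cvgNy cdf_cvgy.

(** The image under the positive part has no mass on the negative axis by
    construction. *)
Let positive_part (x : measurableTypeR R) : R := Num.max (x : R) 0.

Let measurable_positive_part : measurable_fun setT positive_part.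
Proof. by apply: measurable_maxr => //; exact: measurable_id. Qed.

HB.instance Definition _ :=
  @isMeasurableFun.Build _ _ _ _ positive_part measurable_positive_part.

Let idTR : measurableTypeR R -> R := idfun.

HB.instance Definition _ :=
  @isMeasurableFun.Build _ _ _ _ idTR (@measurable_id _ _ setT).

Lemma law_of_tail : exists V : probability R R,
  V `]-oo, 0[%classic = 0%E /\
  forall x : R, 0 < x -> V `]x, +oo[%classic = (T x)%:E.
Proof.
pose mu := lebesgue_stieltjes_measure cdf_of_tail.
exists (distribution mu positive_part); split => [|x x0].
  rewrite /distribution /= /pushforward.
  have -> : positive_part @^-1` `]-oo, 0[%classic = set0; last exact: measure0.
  by apply/seteqP; split => y //=; rewrite /positive_part in_itv/= gt_max ltxx andbF.
have := ccdf_1_cdf (idTR : {RV mu >-> R}) x.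
rewrite cdf_lebesgue_stieltjes_id /= cdf_gt0// -EFinB subKr => <-.
rewrite /ccdf /distribution /= /pushforward; congr (mu _).
apply/seteqP; split => y /=; rewrite /positive_part !in_itv/= !andbT lt_max.
  by case/orP => //; move/(lt_trans x0); rewrite ltxx.
by move=> ->.
Qed.

End law_of_tail.

(** * A subexponential tail that is not dominatedly varying *)

Section lognormal_type_tail.
Variable R : realType.

(** Up to a shift and constants in the exponent, the decay of a lognormal
    law: faster than any power, yet slowly enough to be subexponential. *)
Definition lognormal_tail (x : R) : R := expR (- (ln (1 + x)) ^+ 2).

Local Notation T := lognormal_tail.

Lemma lognormal_tail_gt0 x : 0 < T x.
Proof. exact: expR_gt0. Qed.

Lemma ln1D_ge0 (x : R) : 0 <= x -> 0 <= ln (1 + x).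
Proof. by move=> x0; rewrite ln_ge0// lerDl. Qed.

Lemma ln1D_le (x y : R) : 0 <= x -> x <= y -> ln (1 + x) <= ln (1 + y).
Proof. by move=> x0 xy; rewrite ler_ln ?posrE; lra. Qed.

Lemma lognormal_tail01 x : 0 <= x -> 0 <= T x <= 1.
Proof.
move=> x0; rewrite ltW ?lognormal_tail_gt0//= -expR0 ler_expR oppr_le0.
exact: sqr_ge0.
Qed.

Lemma lognormal_tail_nonincreasing (x y : R) : 0 <= x -> x <= y -> T y <= T x.
Proof.
move=> x0 xy; rewrite ler_expR lerN2 ler_sqr ?nnegrE ?ln1D_ge0 ?ln1D_le//.
exact: le_trans xy.
Qed.

Lemma ln1D_cvg : ln (1 + x) @[x --> (+oo : set_system R)] --> +oo.
Proof.
apply/cvgryPge => A; near=> x.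
have xA : expR A <= 1 + x.
  rewrite -lerBlDl; near: x; apply: nbhs_pinfty_ge; exact: num_real.
by rewrite -[A]expRK ler_ln ?posrE ?expR_gt0// (lt_le_trans _ xA)// expR_gt0.
Unshelve. all: by end_near. Qed.

Lemma lognormal_tail_cvg0 : T x @[x --> +oo] --> 0.
Proof.
have := cvg_comp _ _ (cvg_comp _ _ ln1D_cvg cvgr_expr2) (@cvgr_expR R).
exact.
Qed.

Lemma lognormal_tail_continuous (x : R) : 0 < x -> {for x, continuous T}.
Proof.
move=> x0.
have c1 : 1 + y @[y --> x] --> 1 + x by apply: cvgD => //; exact: cvg_cst.
have c2 : ln (1 + y) @[y --> x] --> ln (1 + x).
  by apply: (cvg_comp _ _ c1); apply: continuous_ln; lra.
apply: (@cvg_comp _ _ _ (fun y => - ln (1 + y) ^+ 2) expR); last exact: continuous_expR.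
by apply: cvgN; exact: cvgM.
Qed.

(** [ln] of a square root is at most that root. *)
Lemma ln1D_le_sqrt (x : R) : 0 <= x -> ln (1 + x) <= 2 * Num.sqrt (1 + x).
Proof.
move=> x0; have s0 : 0 < Num.sqrt (1 + x) by rewrite sqrtr_gt0; lra.
rewrite -{1}(@sqr_sqrtr _ (1 + x)); last lra.
rewrite lnXn// -[leLHS]mulr_natl ler_pM2l//.
exact/ltW/ln_sublinear.
Qed.

(** The exponent is [(u - v) (u + v)] with [u = ln (1 + x)] and
    [v = ln (1 + x - y)]; the first factor is at most [2 y / (1 + x)] and the
    second at most [4 sqrt (1 + x)]. Shifts of order [sqrt x] thus change the
    tail by a bounded factor, and constant shifts by a factor close to 1. *)
Lemma lognormal_tail_shift (x y : R) : 0 <= y -> y <= x / 2 ->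
  T (x - y) <= expR (8 * (y / Num.sqrt (1 + x))) * T x.
Proof.
move=> y0 yx; rewrite -expRD ler_expR -lerBlDr.
have x0 : 0 <= x by lra.
set u := ln (1 + x); set v := ln (1 + (x - y)).
have vu : v <= u by apply: ln1D_le; lra.
have v0 : 0 <= v by apply: ln1D_ge0; lra.
have -> : - v ^+ 2 - - u ^+ 2 = (u - v) * (u + v) by ring.
set s := Num.sqrt (1 + x).
have s0 : 0 < s by rewrite sqrtr_gt0; lra.
have ss : s * s = 1 + x by rewrite -expr2 sqr_sqrtr//; lra.
have uv : u - v <= 2 * (y / (s * s)).
  have xy0 : 0 < 1 + (x - y) by lra.
  rewrite /u /v -ln_div ?posrE//; last lra.
  have -> : (1 + x) / (1 + (x - y)) = 1 + y / (1 + (x - y)).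
    by field; rewrite gt_eqF.
  apply: (le_trans (le_ln1Dx _)).
    by apply: (@lt_le_trans _ _ 0) => //; rewrite divr_ge0// ltW.
  rewrite ss mulrA (mulrC 2) -mulrA ler_wpM2l//.
  rewrite -[leLHS]mul1r ler_pdivrMr// mulrAC ler_pdivlMr; lra.
have us : u + v <= 4 * s.
  have := ln1D_le_sqrt x0; rewrite -/u -/s; lra.
have -> : 8 * (y / s) = 2 * (y / (s * s)) * (4 * s) by field; rewrite gt_eqF.
by apply: ler_pM => //; rewrite ?subr_ge0// addr_ge0// ln1D_ge0.
Qed.

Lemma sqrt_cvg : Num.sqrt x @[x --> (+oo : set_system R)] --> +oo.
Proof.
apply/cvgryPge => A; near=> x.
have [A0|A0] := leP A 0; first exact: (le_trans A0 (sqrtr_ge0 _)).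
rewrite -(ger0_norm (ltW A0)) -sqrtr_sqr; apply: ler_wsqrtr.
near: x; apply: nbhs_pinfty_ge; exact: num_real.
Unshelve. all: by end_near. Qed.

Lemma lognormal_tail_long : long_tail T.
Proof.
move=> y y0.
apply: (@squeeze_cvgr _ _ _ _ (fun=> 1) (fun x => expR (8 * (y / Num.sqrt (1 + x))))).
- near=> x.
  have x2 : 2 * y <= x by near: x; apply: nbhs_pinfty_ge; exact: num_real.
  apply/andP; split.
    rewrite ler_pdivlMr ?lognormal_tail_gt0// mul1r.
    by apply: lognormal_tail_nonincreasing; lra.
  rewrite ler_pdivrMr ?lognormal_tail_gt0//.
  by apply: lognormal_tail_shift; lra.
- exact: cvg_cst.
- have h : (8 * y) * (Num.sqrt (1 + x))^-1 @[x --> +oo] --> (8 * y) * 0.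
    apply: cvgMr; rewrite gtr0_cvgV0; last first.
      near=> x; have x0 : 0 < x by near: x; exact: nbhs_pinfty_gt.
      by rewrite sqrtr_gt0 addr_gt0.
    apply: cvg_comp sqrt_cvg; exact: cvg_addrl.
  rewrite mulr0 in h.
  have := cvg_comp _ _ h (@continuous_expR R 0); rewrite expR0.
  by under [X in X @ _]eq_fun do rewrite /= -mulrA.
Unshelve. all: by end_near. Qed.

(** For the last condition put [u = ln (1 + x)]: the logarithms at [sqrt x] and
    [x / 2] are at least [u / 2] and [u - 1], and
    [u ^ 2 / 4 + (u - 1) ^ 2 - u ^ 2 >= u] once [u >= 16]. *)
Lemma lognormal_tail_big_jump : big_jump_tail T.
Proof.
exists Num.sqrt; split; first exact: sqrt_cvg.
- near=> x.
  have x4 : 4 <= x by near: x; apply: nbhs_pinfty_ge; exact: num_real.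
  rewrite -ler_sqr ?nnegrE ?sqrtr_ge0 ?divr_ge0//; try lra.
  by rewrite sqr_sqrtr; nra.
- exists (expR 8); near=> x.
  have x4 : 4 <= x by near: x; apply: nbhs_pinfty_ge; exact: num_real.
  apply: (@le_trans _ _ (expR (8 * (Num.sqrt x / Num.sqrt (1 + x))) * T x)).
    apply: lognormal_tail_shift; first exact: sqrtr_ge0.
    rewrite -ler_sqr ?nnegrE ?sqrtr_ge0 ?divr_ge0//; try lra.
    by rewrite sqr_sqrtr; nra.
  apply: ler_wpM2r; first exact/ltW/lognormal_tail_gt0.
  rewrite ler_expR -[leRHS]mulr1 ler_pM2l// ler_pdivrMr ?sqrtr_gt0; last lra.
  by rewrite mul1r; apply: ler_wsqrtr; lra.
have L16 : \forall x \near (+oo : set_system R), 16 <= ln (1 + x).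
  exact: (ln1D_cvg (nbhs_pinfty_ge (num_real _))).
apply: (@squeeze_cvgr _ _ _ _ (fun=> 0) (fun x => expR (- ln (1 + x)))).
- near=> x.
  have L : 16 <= ln (1 + x) by near: x.
  have x4 : 4 <= x by near: x; apply: nbhs_pinfty_ge; exact: num_real.
  apply/andP; split; first by rewrite divr_ge0 ?mulr_ge0 ?ltW ?lognormal_tail_gt0.
  rewrite /T -expRD -expRN -expRD ler_expR.
  set u := ln (1 + x) in L *.
  have hs : u / 2 <= ln (1 + Num.sqrt x).
    have s0 : 0 < 1 + Num.sqrt x by rewrite ltr_pwDl// sqrtr_ge0.
    rewrite ler_pdivrMr// mulr_natr -lnXn// ler_ln ?posrE ?exprn_gt0//; last lra.
    rewrite sqrrD sqr_sqrtr; last lra.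
    have := sqrtr_ge0 x; lra.
  have h2 : u - 1 <= ln (1 + x / 2).
    rewrite lerBlDr -[X in _ <= _ + X]expRK -lnM ?posrE ?expR_gt0//; last lra.
    rewrite ler_ln ?posrE ?mulr_gt0 ?expR_gt0//; try lra.
    have := @expR_ge1Dx R 1; nra.
  nra.
- exact: cvg_cst.
- exact: (cvg_comp _ _ ln1D_cvg (@cvgr_expR R)).
Unshelve. all: by end_near. Qed.

(** Halving [x] lowers [ln (1 + x)] by at least [ln (3 / 2)] when [x >= 2], and
    so lowers its square by an unbounded amount. *)
Lemma lognormal_tail_half_unbounded C :
  ~ \forall x \near +oo, T (2^-1 * x) <= C * T x.
Proof.
move=> TC.
have c0 : 0 < ln (3 / 2 : R) by rewrite ln_gt0//; lra.
have LC : \forall x \near (+oo : set_system R),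
    (`|C| + 1) / ln (3 / 2) <= ln (1 + x).
  exact: (ln1D_cvg (nbhs_pinfty_ge (num_real _))).
near (pinfty_nbhs R) => x.
have x2 : 2 <= x by near: x; apply: nbhs_pinfty_ge; exact: num_real.
have uC : (`|C| + 1) / ln (3 / 2) <= ln (1 + x) by near: x.
have : T (2^-1 * x) <= C * T x by near: x.
apply/negP; rewrite -ltNge -ltr_pdivlMr ?lognormal_tail_gt0//.
rewrite /T -expRN -expRD opprK.
set u := ln (1 + x) in uC *; set v := ln (1 + _).
have v0 : 0 <= v by rewrite ln1D_ge0//; lra.
have uv : ln (3 / 2) + v <= u.
  rewrite -lnM ?posrE ?ler_ln ?posrE//; try lra.
have h : ln (3 / 2) * u <= - v ^+ 2 + u ^+ 2.
  have -> : - v ^+ 2 + u ^+ 2 = (u - v) * (u + v) by ring.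
  have u0 : 0 <= u by rewrite ln1D_ge0//; lra.
  by apply: ler_pM; lra.
apply: lt_le_trans (expR_ge1Dx _).
apply: (@lt_le_trans _ _ (ln (3 / 2) * u)); last lra.
rewrite mulrC -ltr_pdivrMr//; apply: lt_le_trans uC.
by rewrite ltr_pM2r ?invr_gt0// (le_lt_trans (ler_norm C))// ltrDl.
Unshelve. all: by end_near. Qed.

End lognormal_type_tail.

(** * Geometry of ruin sets *)

Section ruin_geometry.
Variables (R : realType) (d : nat) (A : set 'rV[R]_d).
Hypothesis A_ruin : @ruin_sets R d A.

Lemma ruin_set_upward (a b : 'rV[R]_d) :
  A a -> (forall j, a ord0 j <= b ord0 j) -> A b.
Proof.
case: A_ruin => _ _ _ Ainc _ Aa ab.
rewrite -(subrK a b) addrC; apply: Ainc => // j.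
by rewrite !mxE subr_ge0.
Qed.

Lemma ruin_set_convexC (a b : 'rV[R]_d) (t : R) :
  ~ A a -> ~ A b -> 0 <= t -> t <= 1 -> ~ A (t *: a + (1 - t) *: b).
Proof.
case: A_ruin => _ _ _ _ [Acvx _] Aa Ab t0 t1.
have Pt : Itv.spec (@Itv.num_sem R) (Itv.Real `[0%Z, 1%Z]) t.
  by rewrite /= /Itv.num_sem/= num_real in_itv/= t0 t1.
have := Acvx a b (Itv.mk Pt).
by rewrite !inE => /(_ Aa Ab).
Qed.

(** Some neighbourhood of 0 avoids [A], and it contains a point with equal
    positive coordinates; everything below that point avoids [A] as well. *)
Lemma ruin_set_box : exists2 e : R, 0 < e &
  forall z : 'rV[R]_d, A z -> exists j, e < z ord0 j.
Proof.
case: A_ruin => _ _ _ _ [_ A0].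
have [e /= e0 eA] : exists2 e : R, 0 < e & forall z, ball 0 e z -> ~ A z.
  have /existsNP[B /not_implyP[/nbhs_ballP[e /= e0 eB] AB]] := A0.
  exists e => // z /eB Bz Az; apply: AB; by exists z.
exists (e / 2); first by rewrite divr_gt0.
move=> z Az; apply: contrapT => /forallNP ze.
apply: (eA (const_mx (e / 2))).
  by split => // i j; rewrite !mxE -ball_normE/= sub0r normrN ger0_norm; lra.
apply: ruin_set_upward Az _ => j; rewrite mxE leNgt; exact/negP.
Qed.

Lemma ruin_set_neq0 : ~ A 0.
Proof.
have [e e0 eA] := ruin_set_box.
by move=> /eA[j]; rewrite mxE ltNge ltW.
Qed.

(** [a] lies on the segment from 0 to [t a], and the complement of [A] is convex
    and contains 0. *)
Lemma ruin_set_expand (a : 'rV[R]_d) (t : R) : 1 <= t -> A a -> A (t *: a).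
Proof.
move=> t1 Aa; apply: contrapT => Ata.
have t0 : 0 < t by lra.
have := @ruin_set_convexC _ _ t^-1 Ata ruin_set_neq0.
rewrite invr_ge0 ltW// invf_le1// t1 scaler0 addr0 scalerA mulVf ?gt_eqF//.
by rewrite scale1r => /(_ isT isT).
Qed.

Lemma ruin_set_absorbs (c : 'rV[R]_d) : (forall j, 0 < c ord0 j) ->
  exists2 t : R, 0 < t & A (t *: c).
Proof.
case: A_ruin => -[a Aa] _ _ _ _ c0.
exists (1 + \sum_j `|a ord0 j| / c ord0 j).
  rewrite ltr_wpDr// sumr_ge0// => j _.
  by rewrite divr_ge0// ltW.
apply: ruin_set_upward Aa _ => j; rewrite mxE -ler_pdivrMr//.
rewrite (bigD1 j)//= (le_trans (ler_norm _))// normrM normfV (ger0_norm (ltW (c0 j))).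
by rewrite addrCA lerDl addr_ge0// sumr_ge0// => i _; rewrite divr_ge0// ltW.
Qed.

Lemma scale_ruin_setE (x : R) : 0 < x -> scale_set x A = [set z | A (x^-1 *: z)].
Proof.
move=> x0; have xn : x != 0 by rewrite gt_eqF.
apply/seteqP; split => z /=.
  by move=> [a Aa <-]; rewrite scalerA mulVf// scale1r.
by move=> Az; exists (x^-1 *: z) => //; rewrite scalerA mulfV// scale1r.
Qed.

Lemma translate_setE (c : 'rV[R]_d) (B : set 'rV[R]_d) :
  translate_set c B = [set z | B (z - c)].
Proof.
apply/seteqP; split => z /=; first by move=> [b Bb <-]; rewrite addrK.
by move=> Bz; exists (z - c) => //; rewrite subrK.
Qed.

Variable c : 'rV[R]_d.
Hypothesis c_gt0 : forall j, 0 < c ord0 j.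

(** For [x > 0] this says that [z] belongs to [x A + v c]; dividing by [x]
    rather than multiplying [A] spares the images of sets. *)
Definition ruinous (x v : R) (z : 'rV[R]_d) := A (x^-1 *: (z - v *: c)).

(** The complement of [ruinous] is the cone over the convex complement of [A],
    sheared by the drift; it is convex in level, time and claim jointly. *)
Lemma ruinous_convexC (x x' v v' t : R) (z z' : 'rV[R]_d) : 0 < x -> 0 < x' ->
  0 <= t -> t <= 1 -> ~ ruinous x v z -> ~ ruinous x' v' z' ->
  ~ ruinous (t * x + (1 - t) * x') (t * v + (1 - t) * v')
      (t *: z + (1 - t) *: z').
Proof.
move=> x0 x'0 t0 t1 nz nz'.
set m := t * x + _.
have m0 : 0 < m by rewrite /m; nra.
have := ruin_set_convexC nz nz' (t := t * x / m).
rewrite divr_ge0 ?mulr_ge0 ?(ltW m0) ?(ltW x0)// ler_pdivrMr// mul1r.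
have -> : t * x <= m by rewrite lerDl mulr_ge0 ?subr_ge0// ltW.
move=> /(_ isT isT); apply: contra_not.
rewrite /ruinous.
congr (A _).
apply/rowP => j; rewrite !mxE.
by rewrite /m; field; rewrite -/m !gt_eqF.
Qed.

Lemma ruinous_nonincreasing_drift (x v v' : R) z : 0 < x -> v <= v' ->
  ruinous x v' z -> ruinous x v z.
Proof.
move=> x0 vv'; move/ruin_set_upward; apply => j; rewrite !mxE.
by rewrite ler_pM2l ?invr_gt0// lerB// ler_pM2r.
Qed.

Lemma ruinous_nonincreasing_level (x x' v : R) z : 0 < x -> x <= x' ->
  ruinous x' v z -> ruinous x v z.
Proof.
move=> x0 xx'; have x'0 : 0 < x' := lt_le_trans x0 xx'.
move=> /(@ruin_set_expand _ (x' / x)); rewrite ler_pdivlMr// mul1r => /(_ xx').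
by rewrite scalerA mulrAC mulfV ?gt_eqF// mul1r.
Qed.

Lemma ruinous_coordinate : exists2 e : R, 0 < e &
  forall (x v : R) z, 0 < x -> ruinous x v z ->
    exists j, e * x + v * c ord0 j < z ord0 j.
Proof.
have [e e0 eA] := ruin_set_box; exists e => // x v z x0 /eA[j].
rewrite !mxE ltr_pdivlMl// => h; exists j; rewrite mulrC; lra.
Qed.

(** Choose [K] with [c / K] outside [A]. If [z - v c] avoided [x A], then [z],
    the sum of it and of [v c], would avoid [(x + K v) A] by convexity. *)
Lemma ruinous_of_higher_level : exists2 K : R, 0 < K &
  forall (x v : R) z, 0 < x -> 0 <= v ->
    ruinous (x + K * v) 0 z -> ruinous x v z.
Proof.
have [e e0 eA] := ruin_set_box.
pose K := 1 + \sum_j c ord0 j / e.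
have K1 : 1 <= K by rewrite lerDl sumr_ge0// => j _; rewrite divr_ge0// ltW.
have K0 : 0 < K by lra.
(* [ruinous K (-1) 0] is membership of [c / K] in [A] *)
have Ac : ~ ruinous K (- 1) 0.
  move/eA => -[j]; rewrite !mxE !add0r -mulNr opprK mul1r ltr_pdivlMl//.
  rewrite -ltr_pdivlMr// ltNge => /negP; apply.
  rewrite /K (bigD1 j)//= addrCA lerDl addr_ge0// sumr_ge0// => i _.
  by rewrite divr_ge0// ltW.
exists K => // x v z x0 v0 Az; apply: contrapT => nz.
have m0 : 0 < x + K * v by rewrite ltr_wpDr// mulr_ge0// ltW.
have := ruin_set_convexC nz Ac (t := x / (x + K * v)).
rewrite (divr_ge0 (ltW x0) (ltW m0)) ler_pdivrMr// mul1r lerDl.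
rewrite (mulr_ge0 (ltW K0) v0).
move=> /(_ isT isT); apply; move: Az; rewrite /ruinous; congr (A _).
apply/rowP => j; rewrite !mxE.
by field; rewrite !gt_eqF.
Qed.

(** Let [J] collect the coordinates where [z] exceeds [v c]. The restriction of
    [z] to [J] dominates [z - v c], so it lies in [x A]; being dominated in turn
    by a multiple of the restriction [c_J] of [c], it shows that [t c_J] lies in
    [A] for some [t]. As [z >= v c_J], it follows that [z] lies in [(v / t) A].
    There are finitely many [J], so one [t] serves them all. *)
Lemma ruinous_drift_level : exists2 k : R, 0 < k &
  forall (x v : R) (z : 'rV[R]_d), 0 < x -> 0 < v -> (forall j, 0 <= z ord0 j) ->
    ruinous x v z -> ruinous (k * v) 0 z.
Proof.
pose cJ (J : {set 'I_d}) : 'rV[R]_d := \row_j (if j \in J then c ord0 j else 0).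
have tP (J : {set 'I_d}) : exists t : R, 0 < t /\
    ((exists2 s, 0 < s & A (s *: cJ J)) -> A (t *: cJ J)).
  have [[s s0 As]|n] := pselect (exists2 s, 0 < s & A (s *: cJ J)).
    by exists s.
  by exists 1; split.
have {tP}[t tP] := choice tP.
pose k := 1 + \sum_J t J.
have k0 : 0 < k.
  by rewrite ltr_wpDr// sumr_ge0// => J _; case: (tP J) => /ltW.
exists k^-1; first by rewrite invr_gt0.
move=> x v z x0 v0 z0 Az.
pose J := [set j | v * c ord0 j < z ord0 j]%SET.
have AJ : A (k *: cJ J).
  have AtJ : A (t J *: cJ J).
    apply: (tP J).2.
    exists (x^-1 * (1 + \sum_j z ord0 j / c ord0 j)).
      rewrite mulr_gt0 ?invr_gt0// ltr_wpDr// sumr_ge0// => j _.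
      by rewrite divr_ge0// ltW.
    apply: ruin_set_upward Az _ => j; rewrite !mxE inE -mulrA ler_pM2l ?invr_gt0//.
    case: ltP => [vz|]; last by rewrite mulr0 subr_le0.
    apply: (@le_trans _ _ (z ord0 j)).
      by rewrite gerDl oppr_le0 mulr_ge0// ltW.
    rewrite -ler_pdivrMr// (bigD1 j)//= addrCA lerDl addr_ge0// sumr_ge0// => i _.
    by rewrite divr_ge0// ltW.
  have -> : k *: cJ J = (k / t J) *: (t J *: cJ J).
    by rewrite scalerA divfK// gt_eqF//; case: (tP J).
  apply: ruin_set_expand => //; rewrite ler_pdivlMr ?mul1r; last by case: (tP J).
  rewrite /k (bigD1 J)//= addrCA lerDl addr_ge0// sumr_ge0// => I _.
  by case: (tP I) => /ltW.
apply: ruin_set_upward AJ _ => j; rewrite !mxE inE mul0r subr0 invfM invrK.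
rewrite -mulrA ler_pM2l// ler_pdivlMl//.
by case: ifPn => [/ltW//|_]; rewrite mulr0.
Qed.

End ruin_geometry.

(** * The integrated tail as a product measure *)

Section measurability.
Variables (R : realType) (d : nat).

Lemma measurable_open_Rd (B : set 'rV[R]_d) : open B ->
  measurable (B : set (Rd R d)).
Proof. by move=> oB; exact: sub_sigma_algebra. Qed.

Lemma measurable_continuous_Rd (f : Rd R d -> R) :
  continuous (f : 'rV[R]_d -> R) -> measurable_fun setT f.
Proof.
move=> cf; apply: (measurability _ (RGenOInfty.measurableE R)) => _ [_ [a ->] <-].
rewrite setTI; apply: measurable_open_Rd.
apply: (@open_comp _ _ (f : 'rV[R]_d -> R)); last exact: interval_open.
by move=> z _; exact: cf.
Qed.

End measurability.

(** An initial segment of the half-line has its right end as length. The last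
    hypothesis says that the right end of [Im] is at most the interpolation of
    those of [Ia] and [Ib]; it is applied just beyond those ends. *)
Lemma interval_length_convex (R : realType) (t M : R) (Ia Ib Im : set R) :
  let mu := @lebesgue_measure R in
  0 <= t -> t <= 1 ->
  measurable Ia -> measurable Ib -> measurable Im ->
  (forall v, Ia v -> 0 <= v <= M) -> (forall v, Ib v -> 0 <= v <= M) ->
  (forall v, Im v -> 0 <= v) ->
  (forall v w : R, 0 <= v -> v <= w -> Ia w -> Ia v) ->
  (forall v w : R, 0 <= v -> v <= w -> Ib w -> Ib v) ->
  (forall v w : R, 0 <= v -> v <= w -> Im w -> Im v) ->
  (forall v w : R, 0 <= v -> 0 <= w -> ~ Ia v -> ~ Ib w ->
    ~ Im (t * v + (1 - t) * w)) ->
  (mu Im <= t%:E * mu Ia + (1 - t)%:E * mu Ib)%E.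
Proof.
move=> mu t0 t1 mA mB mM Ia0 Ib0 Im0 Iad Ibd Imd Iconv.
have fin (I : set R) : measurable I -> (forall v, I v -> 0 <= v <= M) -> 
    mu I \is a fin_num.
  move=> mI IM; rewrite ge0_fin_numE//.
  apply: (@le_lt_trans _ _ (mu `[0%R, M]%classic)).
    by rewrite le_measure ?inE// => v /IM; rewrite /= in_itv.
  by rewrite /mu lebesgue_measure_itv/=; case: ifP => _; rewrite ?ltry// -EFinD ltry.
have out (I : set R) (e : R) : measurable I -> mu I \is a fin_num ->
    (forall v w : R, 0 <= v -> v <= w -> I w -> I v) -> 0 < e ->
    ~ I (fine (mu I) + e).
  move=> mI fI Id e0 Ie.
  have a0 : 0 <= fine (mu I) by rewrite fine_ge0.
  have : (mu `[0%R, (fine (mu I) + e)%R]%classic <= mu I)%E.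
    rewrite le_measure ?inE// => v /=; rewrite in_itv/= => /andP[v0 vI].
    exact: Id vI Ie.
  rewrite /mu lebesgue_measure_itv/= lte_fin -/mu ltr_wpDl// -EFinB subr0.
  by rewrite -{2}(fineK fI) lee_fin gerDl leNgt e0.
have fa := fin _ mA Ia0; have fb := fin _ mB Ib0.
rewrite -(fineK fa) -(fineK fb) -!EFinM -EFinD.
apply/lee_addgt0Pr => e e0; rewrite -EFinD.
have na := out _ _ mA fa Iad e0; have nb := out _ _ mB fb Ibd e0.
set a := fine (mu Ia) in na *; set b := fine (mu Ib) in nb *.
have a0 : 0 <= a by rewrite fine_ge0.
have b0 : 0 <= b by rewrite fine_ge0.
have := Iconv _ _ _ _ na nb => /(_ (addr_ge0 a0 (ltW e0)) (addr_ge0 b0 (ltW e0))).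
have -> : t * (a + e) + (1 - t) * (b + e) = t * a + (1 - t) * b + e by ring.
set r := _ + e => nr.
have r0 : 0 <= r by rewrite /r; nra.
apply: (@le_trans _ _ (mu `[0%R, r]%classic)).
  rewrite le_measure ?inE// => v Iv; rewrite /= in_itv/= Im0//= leNgt.
  by apply/negP => rv; apply: nr; apply: Imd Iv => //; exact: ltW.
rewrite /mu lebesgue_measure_itv/= lte_fin; case: ifP => _; last by rewrite lee_fin.
by rewrite -EFinB subr0.
Qed.

Section exit_times.
Variables (R : realType) (d : nat) (A : set 'rV[R]_d).
Hypothesis A_ruin : @ruin_sets R d A.
Variable c : 'rV[R]_d.
Hypothesis c_gt0 : forall j, 0 < c ord0 j.
Variables (disp : measure_display) (T : measurableType disp)
  (P : probability T R) (X : {RV P >-> Rd R d}).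

(** Its sections at [v] carry the integrand of the integrated tail, and its
    sections at [w] are the initial segments of times during which the claim
    [X w] stays in [x A] under the drift. *)
Definition ruin_region (x : R) : set (T * R) :=
  [set wv | 0 <= wv.2 /\ ruinous A c x wv.2 (X wv.1)].

Local Notation mu := (P \x (@lebesgue_measure R))%E.

Lemma open_ruinous (x v : R) : open [set z | ruinous A c x v z].
Proof.
case: A_ruin => _ _ oA _ _; rewrite /ruinous.
have cf : continuous (fun z : 'rV[R]_d => x^-1 *: (z - v *: c)).
  move=> z; apply: (@cvgZl_tmp R 'rV[R]_d _ (nbhs z) _ x^-1 (fun z => z - v *: c)).
  apply: (@cvgB R 'rV[R]_d _ (nbhs z) _ id (cst (v *: c))); first exact: cvg_id.
  exact: cvg_cst.
apply: (@open_comp 'rV[R]_d 'rV[R]_d (fun z => x^-1 *: (z - v *: c)) A) => // z _.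
Qed.

Lemma measurable_ruinous (x v : R) : measurable [set w | ruinous A c x v (X w)].
Proof.
rewrite -[X in measurable X]setTI.
apply: (measurable_funPT X measurableT [set z | ruinous A c x v z]).
by apply: measurable_open_Rd; exact: open_ruinous.
Qed.

(** [A] is open and the sections are initial segments, so that membership at
    time [v] amounts to membership at some later rational time. *)
Lemma measurable_ruin_region (x : R) : 0 < x -> measurable (ruin_region x).
Proof.
move=> x0.
have -> : ruin_region x = \bigcup_(q : rat)
    ([set w | ruinous A c x (ratr q) (X w)] `*` `[0, (ratr q : R)[%classic).
  apply/seteqP; split => [[w v] [/= v0 rv]|[w v] [q _ [/= rq]]]; last first.
    rewrite in_itv/= => /andP[v0 vq]; split => //=.
    exact: ruinous_nonincreasing_drift (ltW vq) rq.
  have : \forall u \near v, ruinous A c x u (X w).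
    case: A_ruin => _ _ oA _ _.
    have cf : continuous (fun u : R => x^-1 *: (X w - u *: c) : 'rV[R]_d).
      move=> u.
      apply: (@cvgZl_tmp R 'rV[R]_d _ (nbhs u) _ x^-1 (fun u => X w - u *: c)).
      apply: (@cvgB R 'rV[R]_d _ (nbhs u) _ (cst (X w : 'rV[R]_d)) (fun u => u *: c)).
        exact: cvg_cst.
      by apply: cvgZr_tmp; exact: cvg_id.
    exact: (cf v _ (open_nbhs_nbhs (conj oA rv))).
  move=> /nbhs_ballP[e /= e0 eB].
  have [q] := @rat_in_itvoo R v (v + e) ltac:(by rewrite ltrDl).
  rewrite in_itv/= => /andP[vq qe]; exists q => //=; split => /=; last first.
    by rewrite in_itv/= v0.
  apply: eB; rewrite /ball/= ltr0_norm; lra.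
apply: bigcupT_measurable_rat => q; apply: measurableX => //.
exact: measurable_ruinous.
Qed.

Lemma ruin_regionE (x : R) : 0 < x ->
  mu (ruin_region x) =
    (\int[lebesgue_measure]_v P (ysection (ruin_region x) v))%E.
Proof.
move=> x0; have mx := measurable_ruin_region x0.
have := indic_fubini_tonelli P (@lebesgue_measure R) mx.
by rewrite indic_fubini_tonelli_FE// indic_fubini_tonelli_GE.
Qed.

Lemma ysection_ruin_region (x v : R) : 0 <= v ->
  ysection (ruin_region x) v = [set w | ruinous A c x v (X w)].
Proof.
move=> v0; apply/seteqP; split => w; rewrite /ysection /ruin_region /= inE/=.
  by case.
by [].
Qed.

Lemma ysection_ruin_region_lt0 (x v : R) : v < 0 ->
  ysection (ruin_region x) v = set0.
Proof.
move=> v0; apply/seteqP; split => w //; rewrite /ysection /ruin_region /= inE/=.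
by move=> [] /le_lt_trans /(_ v0); rewrite ltxx.
Qed.

Lemma integral_translate_ruin_region (x : R) : 0 < x ->
  (\int[lebesgue_measure]_(v in `[0%R, +oo[%classic)
     distribution P X (translate_set (v *: c) (scale_set x A)) =
   mu (ruin_region x))%E.
Proof.
move=> x0; rewrite ruin_regionE// [LHS]integral_mkcond.
apply: eq_integral => v _; rewrite patchE; case: ifPn.
  rewrite inE/= in_itv/= andbT => v0; rewrite ysection_ruin_region//.
  by rewrite translate_setE scale_ruin_setE.
rewrite notin_setE/= in_itv/= andbT => /negP; rewrite -ltNge => v0.
by rewrite ysection_ruin_region_lt0 ?measure0.
Qed.

(** After this time the drift has carried all coordinates of [X w] below 0, away
    from every [x A]. *)
Definition exit_bound (w : T) : R := \sum_j `|X w ord0 j| / c ord0 j.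

Lemma exit_bound_ge0 w : 0 <= exit_bound w.
Proof. by apply: sumr_ge0 => j _; rewrite divr_ge0// ltW. Qed.

Lemma ruin_region_bounded (x v : R) w : 0 < x -> ruin_region x (w, v) ->
  0 <= v <= exit_bound w.
Proof.
move=> x0 [/= v0]; rewrite v0/=.
have [e e0 /[apply]] := ruinous_coordinate A_ruin c.
move=> /(_ x0)[j xj]; rewrite /exit_bound (bigD1 j)//=.
apply: (@le_trans _ _ (`|X w ord0 j| / c ord0 j)).
  rewrite ler_pdivlMr// (le_trans _ (ler_norm _))// (le_trans _ (ltW xj))//.
  by rewrite lerDr mulr_ge0// ltW.
by rewrite lerDl sumr_ge0// => i _; rewrite divr_ge0// ltW.
Qed.

Lemma xsection_ruin_region_down (x : R) w v v' : 0 < x -> 0 <= v -> v <= v' ->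
  xsection (ruin_region x) w v' -> xsection (ruin_region x) w v.
Proof.
move=> x0 v0 vv'; rewrite /xsection /= !inE => -[_ rv']; split => //=.
exact: ruinous_nonincreasing_drift vv' rv'.
Qed.

(** Convexity of the mean exit time, from that of the exit time for each
    outcome. *)
Lemma ruin_region_convex (x y t : R) : 0 < x -> 0 < y -> 0 <= t -> t <= 1 ->
  (mu (ruin_region (t * x + (1 - t) * y)) <=
   t%:E * mu (ruin_region x) + (1 - t)%:E * mu (ruin_region y))%E.
Proof.
move=> x0 y0 t0 t1; set m := t * x + _.
have m0 : 0 < m by rewrite /m; nra.
have mx := measurable_ruin_region x0.
have my := measurable_ruin_region y0.
have mm := measurable_ruin_region m0.
have mxs B : measurable B ->
    measurable_fun setT ((@lebesgue_measure R) \o xsection B : T -> \bar R).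
  exact: measurable_fun_xsection.
rewrite /product_measure1.
rewrite -!ge0_integralZl//; try exact: mxs; try by rewrite lee_fin subr_ge0.
rewrite -ge0_integralD//; last 4 first.
- by move=> w _; rewrite mule_ge0// lee_fin.
- by apply: measurable_funeM; exact: mxs.
- by move=> w _; rewrite mule_ge0// lee_fin subr_ge0.
- by apply: measurable_funeM; exact: mxs.
apply: ge0_le_integral => //; first exact: mxs.
  by apply: emeasurable_funD; apply: measurable_funeM; exact: mxs.
move=> w _ /=; apply: (@interval_length_convex _ t (exit_bound w)) => //.
- exact: measurable_xsection.
- exact: measurable_xsection.
- exact: measurable_xsection.
- by move=> v; rewrite /xsection/= inE; exact: ruin_region_bounded.
- by move=> v; rewrite /xsection/= inE; exact: ruin_region_bounded.
- by move=> v; rewrite /xsection/= inE => -[].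
- by move=> v v'; exact: xsection_ruin_region_down.
- by move=> v v'; exact: xsection_ruin_region_down.
- by move=> v v'; exact: xsection_ruin_region_down.
move=> v v' v0 v'0; rewrite /xsection/= !inE => nv nv' [/= _].
have := @ruinous_convexC _ _ _ A_ruin c _ _ v v' _ (X w) (X w) x0 y0 t0 t1.
rewrite -scalerDl addrCA subrr addr0 scale1r; apply.
  by move=> rv; apply: nv.
by move=> rv; apply: nv'.
Qed.

Lemma ruin_region_nonincreasing (x y : R) : 0 < x -> x <= y ->
  ruin_region y `<=` ruin_region x.
Proof.
move=> x0 xy [w v] [/= v0 rv]; split => //=.
exact: ruinous_nonincreasing_level rv.
Qed.

Hypothesis X_ge0 : {ae P, forall w, orthant (X w)}.
Hypothesis EX_fin : forall j : 'I_d, ('E_P[coordinate X j] < +oo)%E.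

Lemma measurable_coordinate j : measurable_fun setT (coordinate X j).
Proof.
apply: (@measurableT_comp _ _ _ _ _ _ (fun z : Rd R d => z ord0 j)).
  apply: measurable_continuous_Rd; exact: coord_continuous.
exact: measurable_funPT.
Qed.

Lemma measurable_exit_term j :
  measurable_fun setT (fun w => `|coordinate X j w| / c ord0 j).
Proof.
apply: measurable_funM => //; apply: measurableT_comp => //.
exact: measurable_coordinate.
Qed.

Lemma measurable_exit_bound : measurable_fun setT exit_bound.
Proof. by apply: measurable_sum => j; exact: measurable_exit_term. Qed.

Lemma integral_exit_bound : (\int[P]_w (exit_bound w)%:E < +oo)%E.
Proof.
rewrite /exit_bound; under eq_integral do rewrite -sumEFin.
rewrite ge0_integral_sum//; last 2 first.
- by move=> j; apply/measurable_EFinP; exact: measurable_exit_term.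
- by move=> j w _; rewrite lee_fin divr_ge0// ltW.
apply: lte_sum_pinfty => j _.
under eq_integral do rewrite mulrC EFinM.
rewrite ge0_integralZl//; last 2 first.
- apply/measurable_EFinP; apply: measurableT_comp => //.
  exact: measurable_coordinate.
- by rewrite lee_fin invr_ge0 ltW.
apply: lte_mul_pinfty => //; first by rewrite lee_fin invr_ge0 ltW.
rewrite (le_lt_trans _ (EX_fin j))// unlock.
rewrite (ae_eq_integral (fun w => (coordinate X j w)%:E))//.
- apply/measurable_EFinP; apply: measurableT_comp => //.
  exact: measurable_coordinate.
- by apply/measurable_EFinP; exact: measurable_coordinate.
- by apply: filterS X_ge0 => w Xw _; rewrite ger0_norm.
Qed.

End exit_times.

(** * Regularity of the integrated tail *)

Section ruin_mass.
Variables (R : realType) (d : nat) (A : set 'rV[R]_d).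
Hypothesis A_ruin : @ruin_sets R d A.
Variable c : 'rV[R]_d.
Hypothesis c_gt0 : forall j, 0 < c ord0 j.
Variables (disp : measure_display) (T : measurableType disp)
  (P : probability T R) (X : {RV P >-> Rd R d}).
Hypothesis X_ge0 : {ae P, forall w, orthant (X w)}.
Hypothesis EX_fin : forall j : 'I_d, ('E_P[coordinate X j] < +oo)%E.

Local Notation mu := (P \x (@lebesgue_measure R))%E.
Local Notation region := (ruin_region A c X).

Definition ruin_mass (x : R) : R := fine (mu (region x)).
Local Notation g := ruin_mass.

Let mregion x : 0 < x -> measurable (region x).
Proof. exact: measurable_ruin_region. Qed.

Let mu_ge0 B : (0 <= mu B)%E.
Proof. by apply: integral_ge0. Qed.

Lemma ruin_mass_fin (x : R) : 0 < x -> mu (region x) \is a fin_num.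
Proof.
move=> x0; rewrite ge0_fin_numE//.
apply: le_lt_trans (integral_exit_bound c_gt0 X_ge0 EX_fin).
rewrite /product_measure1; apply: ge0_le_integral => //.
- by apply: measurable_fun_xsection; exact: mregion.
- apply/measurable_EFinP; exact: measurable_exit_bound.
move=> w _ /=.
apply: (@le_trans _ _ (@lebesgue_measure R `[0%R, exit_bound c X w]%classic)).
  rewrite le_measure ?inE//; first by apply: measurable_xsection; exact: mregion.
  move=> v; rewrite /xsection/= inE => /(ruin_region_bounded A_ruin c_gt0 x0).
  by rewrite in_itv.
rewrite lebesgue_measure_itv/= lte_fin; case: ifP => _.
  by rewrite -EFinB subr0.
by rewrite lee_fin exit_bound_ge0.
Qed.

Lemma ruin_massE (x : R) : 0 < x -> mu (region x) = (g x)%:E.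
Proof. by move=> x0; rewrite /ruin_mass fineK// ruin_mass_fin. Qed.

Lemma ruin_mass_ge0 x : 0 <= g x.
Proof. by rewrite fine_ge0// mu_ge0. Qed.

Lemma ruin_mass_nonincreasing (x y : R) : 0 < x -> x <= y -> g y <= g x.
Proof.
move=> x0 xy; have y0 := lt_le_trans x0 xy.
rewrite -lee_fin -(ruin_massE x0) -(ruin_massE y0).
rewrite le_measure ?inE//; try exact: mregion.
exact: ruin_region_nonincreasing.
Qed.

Lemma ruin_mass_convex (x y t : R) : 0 < x -> 0 < y -> 0 <= t -> t <= 1 ->
  g (t * x + (1 - t) * y) <= t * g x + (1 - t) * g y.
Proof.
move=> x0 y0 t0 t1; have m0 : 0 < t * x + (1 - t) * y by nra.
have := ruin_region_convex A_ruin c_gt0 X x0 y0 t0 t1.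
by rewrite (ruin_massE x0) (ruin_massE y0) (ruin_massE m0).
Qed.

(** Convexity at the points [x / 2 <= x <= y], with the weight of [g y] raised
    to 1. *)
Lemma ruin_mass_slope (x y : R) : 0 < x -> x <= y ->
  g x - g y <= (y - x) / x * 2 * g (x / 2).
Proof.
move=> x0 xy; pose t := (y - x) / (y - x / 2).
have e0 : 0 < y - x / 2 by lra.
have t0 : 0 <= t by rewrite divr_ge0; lra.
have t1 : t <= 1 by rewrite ler_pdivrMr//; lra.
have x2 : 0 < x / 2 by lra.
have := ruin_mass_convex x2 (lt_le_trans x0 xy) t0 t1.
have -> : t * (x / 2) + (1 - t) * y = x by rewrite /t; field; apply: lt0r_neq0; lra.
have t2 : t <= (y - x) / x * 2.
  rewrite /t -mulrA ler_wpM2l ?subr_ge0// mulrC -[2](@invrK R) -invfM.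
  by rewrite lef_pV2 ?posrE; lra.
move: (ruin_mass_ge0 x) (ruin_mass_ge0 y) (ruin_mass_ge0 (x / 2)).
generalize (g x) (g y) (g (x / 2)) => gx gy gx2 _ gy0 gx20 cvx.
have h1 := mulr_ge0 t0 gy0; have h2 := ler_wpM2r gx20 t2.
lra.
Qed.

Lemma ruin_mass_right_continuous (x : R) : 0 < x -> g @ x^'+ --> g x.
Proof.
move=> x0.
pose K := 2 / x * g (x / 2).
apply: (@squeeze_cvgr _ _ _ _ (fun y => g x - (y - x) * K) (fun=> g x)).
- near=> y; have xy : x < y by near: y; exact: nbhs_right_gt.
  apply/andP; split; last exact/ruin_mass_nonincreasing/ltW.
  have := ruin_mass_slope x0 (ltW xy).
  have -> : (y - x) / x * 2 * g (x / 2) = (y - x) * K by rewrite /K; field; apply: lt0r_neq0; lra.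
  lra.
- apply: cvg_at_right_filter.
  rewrite -[X in _ --> X](_ : g x - (x - x) * K = g x); last by rewrite subrr mul0r subr0.
  apply: cvgB; first exact: cvg_cst.
  apply: cvgM; last exact: cvg_cst.
  by apply: cvgB; [exact: cvg_id|exact: cvg_cst].
- exact: cvg_cst.
Unshelve. all: by end_near. Qed.

(** The regions decrease to the empty set, since a claim vector is bounded while
    the levels are not, and their measures are finite. *)
Lemma ruin_mass_cvg0 : g x @[x --> +oo] --> 0.
Proof.
have cvgn : (fun n : nat => mu (region n.+1%:R)) @ \oo --> (0 : \bar R).
  have -> : (0 : \bar R)%E = mu (\bigcap_n region n.+1%:R).
    apply/esym; rewrite (_ : \bigcap_n _ = set0) ?measure0//.
    apply/seteqP; split => [[w v] reg|//] /=.
    have [e e0 re] := ruinous_coordinate A_ruin c.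
    pose B := \sum_j `|X w ord0 j|.
    have [n nB] : exists n : nat, B < e * n.+1%:R.
      exists (Num.bound (B / e)); rewrite mulrC -ltr_pdivrMr//.
      apply: (lt_trans (archi_boundP _)); first by rewrite divr_ge0 ?sumr_ge0// ltW.
      by rewrite ltr_nat.
    have [/= v0 /re] := reg n I.
    move=> /(_ (ltr0Sn _ _))[j ej].
    have jB : X w ord0 j <= B.
      rewrite /B (bigD1 j)//= (le_trans (ler_norm _))// lerDl.
      by rewrite sumr_ge0.
    have := mulr_ge0 v0 (ltW (c_gt0 j)); lra.
  apply: nonincreasing_cvg_mu.
  - by rewrite -ge0_fin_numE ?mu_ge0// ruin_mass_fin.
  - by move=> n; exact: mregion.
  - by apply: bigcap_measurable => // n _; exact: mregion.
  - move=> m n mn; apply/subsetPset; apply: ruin_region_nonincreasing => //.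
    by rewrite ler_nat.
move/fine_cvg in cvgn.
apply/cvgr0Pnorm_le => /= e e0.
move/cvgr0Pnorm_le : cvgn => /(_ _ e0)[n _ /(_ n (leqnn n)) /= gn].
near=> x.
have nx : n.+1%:R <= x by near: x; apply: nbhs_pinfty_ge; exact: num_real.
rewrite ger0_norm ?ruin_mass_ge0//.
apply: le_trans (ruin_mass_nonincreasing _ nx) _ => //.
exact: (le_trans (ler_norm _)).
Unshelve. all: by end_near. Qed.

Variable V : probability R R.
Hypothesis V_law : radial_law (distribution P X) A V.
Hypothesis V_D : dominatedly_varying V.

Lemma radial_tailE (x : R) : 0 < x ->
  P [set w | ruinous A c x 0 (X w)] = (tail V x)%:E.
Proof.
move=> x0; rewrite -tailE; case: V_law => _ ->//.
rewrite scale_ruin_setE// /distribution /pushforward.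
have -> : X @^-1` [set z | A (x^-1 *: z)] = [set w | ruinous A c x 0 (X w)].
  by apply/seteqP; split => w; rewrite /ruinous/= scale0r subr0.
by rewrite min_r// probability_le1//; exact: measurable_ruinous.
Qed.

Lemma ruinous_ge_tail : exists2 K : R, 0 < K & forall (x v : R), 0 < x -> 0 <= v ->
  ((tail V (x + K * v))%:E <= P [set w | ruinous A c x v (X w)])%E.
Proof.
have [K K0 KP] := ruinous_of_higher_level A_ruin c_gt0.
exists K => // x v x0 v0; rewrite -radial_tailE; last first.
  by rewrite ltr_wpDr// mulr_ge0// ltW.
rewrite le_measure ?inE//; try exact: measurable_ruinous.
by move=> w; exact: KP.
Qed.

(** The geometric bound requires nonnegative claims, hence the null set [N] on
    which they may fail to be so. *)
Lemma ruinous_le_tail : exists2 k : R, 0 < k & forall (x v : R), 0 < x -> 0 <= v ->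
  (P [set w | ruinous A c x v (X w)] <= (tail V (Num.max x (k * v)))%:E)%E.
Proof.
have [k k0 kP] := ruinous_drift_level A_ruin c_gt0.
exists k => // x v x0 v0.
have m0 : 0 < Num.max x (k * v) by rewrite lt_max x0.
rewrite -radial_tailE//.
have [N [mN N0 XN]] := X_ge0.
have mr y u := measurable_ruinous A_ruin c X y u.
apply: (@le_trans _ _ (P ([set w | ruinous A c (Num.max x (k * v)) 0 (X w)] `|` N))).
  rewrite le_measure ?inE//; first exact: measurableU.
  move=> w /= rw; have [Nw|Nw] := pselect (N w); [by right|left].
  have Xw : orthant (X w) by apply: contrapT => /XN.
  have [xkv|_] := ltP x (k * v); last exact: ruinous_nonincreasing_drift rw.
  apply: (kP x) => //; rewrite lt_neqAle v0 andbT; apply/eqP => v0'.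
  by move: xkv; rewrite -v0' mulr0 ltNge ltW.
rewrite -[leRHS]adde0 -N0; exact: measureU2.
Qed.

Lemma ruin_mass_gt0 (x : R) : 0 < x -> 0 < g x.
Proof.
move=> x0; have [K K0 KP] := ruinous_ge_tail.
rewrite -lte_fin -ruin_massE//.
have mr := measurable_ruinous A_ruin c X x 1.
apply: (@lt_le_trans _ _ (mu ([set w | ruinous A c x 1 (X w)] `*` `[0%R, 1%R]%classic))).
  rewrite product_measure1E//= lebesgue_measure_itv/= lte_fin ltr01 -EFinB subr0 mule1.
  apply: lt_le_trans (KP x 1 x0 ler01); rewrite lte_fin; apply: V_D.1.
  by rewrite mulr1 addr_gt0.
rewrite le_measure ?inE//; [exact: measurableX|exact: mregion|].
move=> [w v] /= [rw]; rewrite in_itv/= => /andP[v0 v1]; split => //=.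
exact: ruinous_nonincreasing_drift rw.
Qed.

(** With [M = 1 / b + K / k] one has [x + K v <= M max (b x) (k v)] for every
    time [v], so dominated variation of the tail of [V] for the factor [1 / M]
    compares the integrands uniformly in [v]. *)
Lemma ruin_mass_dominated (b : R) : 0 < b < 1 ->
  exists C, \forall x \near +oo, g (b * x) <= C * g x.
Proof.
move=> /andP[b0 b1].
have [K K0 KP] := ruinous_ge_tail.
have [k k0 kP] := ruinous_le_tail.
pose M := b^-1 + K / k.
have bi : 1 < b^-1 by rewrite invf_gt1.
have Kk : 0 < K / k by rewrite divr_gt0.
have M1 : 1 < M by rewrite /M; lra.
have M0 : 0 < M by lra.
have [C [u0 [_ CP]]] : exists C, \forall u \near +oo, tail V (M^-1 * u) <= C * tail V u.
  apply/(near_tail_ratio_bounded _ V_D.1); apply: V_D.2.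
  by rewrite invr_gt0 M0 invf_lt1.
exists (Num.max C 0); near=> x.
have x0 : 0 < x by near: x; exact: nbhs_pinfty_gt.
have xu : u0 / M / b < x by near: x; apply: nbhs_pinfty_gt; exact: num_real.
have bx0 : 0 < b * x by rewrite mulr_gt0.
have C0 : 0 <= Num.max C 0 by rewrite le_max lexx orbT.
rewrite -lee_fin EFinM -!ruin_massE// !ruin_regionE// -ge0_integralZl//; last first.
  by apply: measurable_fun_ysection; exact: mregion.
apply: ge0_le_integral => //.
- by apply: measurable_fun_ysection; exact: mregion.
- by apply: measurable_funeM; apply: measurable_fun_ysection; exact: mregion.
move=> v _; have [v0|v0] := leP 0 v; last first.
  by rewrite !ysection_ruin_region_lt0// measure0 mule0.
rewrite !ysection_ruin_region//.
apply: le_trans (kP _ _ bx0 v0) _.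
apply: le_trans (lee_wpmul2l _ (KP _ _ x0 v0)); last by rewrite lee_fin.
rewrite -EFinM lee_fin; set m := Num.max _ _.
have m1 : b * x <= m by rewrite le_max lexx.
have m2 : k * v <= m by rewrite le_max lexx orbT.
have mM : x + K * v <= M * m.
  rewrite /M mulrDl lerD//; first by rewrite ler_pdivlMl.
  by rewrite -mulrA ler_pM2l// ler_pdivlMl.
have uM : u0 < M * m.
  apply: (@lt_le_trans _ _ (M * (b * x))); last by rewrite ler_pM2l.
  by rewrite -ltr_pdivrMl// -ltr_pdivrMl// (mulrC b^-1) (mulrC M^-1).
have := CP _ uM; rewrite mulKf ?gt_eqF// => /le_trans; apply.
apply: (@le_trans _ _ (Num.max C 0 * tail V (M * m))).
  by rewrite ler_wpM2r ?tail_ge0// le_max lexx.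
by rewrite ler_wpM2l// tail_nonincreasing.
Unshelve. all: by end_near. Qed.

End ruin_mass.

Lemma cvg_min1 (R : realType) (F : set_system R) (f : R -> R) (l : R) :
  Filter F -> f x @[x --> F] --> l ->
  Num.min 1 (f x) @[x --> F] --> Num.min 1 l.
Proof.
move=> FF /cvgrPdist_le fl; apply/cvgrPdist_le => e e0.
near=> x; have : `|l - f x| <= e by near: x; exact: fl.
rewrite !ler_distlC => /andP[h1 h2].
by case: (lerP 1 (f x)) => h3; case: (lerP 1 l) => h4; apply/andP; split; lra.
Unshelve. all: by end_near. Qed.

(** A tail whose slope at [x] is of the order of its value near [x / 2] divided
    by [x]: dominated variation bounds the latter by a multiple of the tail at
    [x], so that a shift by [y] changes the tail by a fraction of order [y / x].
    *)
Lemma dominatedly_varying_long_tailed_of_slope (R : realType)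
    (W : probability R R) (g : R -> R) (theta : R) :
  0 < theta ->
  (forall x : R, 0 < x -> 0 < tail W x) ->
  (\forall x \near +oo, tail W x = g x / theta) ->
  (forall x : R, 0 < x -> 0 < g x) ->
  (forall x y : R, 0 < x -> x <= y -> g y <= g x) ->
  (forall x y : R, 0 < x -> x <= y ->
    g x - g y <= (y - x) / x * 2 * g (x / 2)) ->
  (forall b : R, 0 < b < 1 ->
    exists C, \forall x \near +oo, g (b * x) <= C * g x) ->
  (@dominatedly_varying R `&` @long_tailed R) W.
Proof.
move=> theta_gt0 W_gt0 gW g0 g_nonincreasing g_slope g_dominated.
have gWc (f : R -> R) : f x @[x --> +oo] --> +oo ->
    \forall x \near +oo, tail W (f x) = g (f x) / theta.
  by move=> fy; exact: (fy (fun z => tail W z = g z / theta) gW).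
split; split => //.
- move=> b b01; apply/near_tail_ratio_bounded => //.
  have [C gC] := g_dominated _ b01.
  have b0 : 0 < b by case/andP: b01.
  exists C; near=> x.
  have -> : tail W x = g x / theta by near: x.
  have -> : tail W (b * x) = g (b * x) / theta.
    by near: x; exact: gWc (cvg_pinfty_mull b0).
  have gbx : g (b * x) <= C * g x by near: x.
  have ti : 0 < theta^-1 by rewrite invr_gt0.
  by rewrite mulrA (ler_pM2r ti).
- move=> y y0.
  have b01 : 0 < (4^-1 : R) < 1 by lra.
  have [C gC] := g_dominated _ b01.
  have gy := gWc _ (@cvg_pinfty_subr R y).
  apply: (@squeeze_cvgr _ _ _ _ (fun=> 1) (fun x => 1 + 4 * y * C / x)).
  + near=> x.
    have x0 : 0 < x by near: x; exact: nbhs_pinfty_gt.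
    have xy : 2 * y < x by near: x; apply: nbhs_pinfty_gt; exact: num_real.
    have -> : tail W x = g x / theta by near: x.
    have -> : tail W (x - y) = g (x - y) / theta.
      by near: x.
    have -> : g (x - y) / theta / (g x / theta) = g (x - y) / g x.
      by rewrite invfM invrK mulrACA mulVf ?mulr1// gt_eqF.
    have xy0 : 0 < x - y by lra.
    have gx := g0 x x0.
    rewrite ler_pdivlMr// ler_pdivrMr// mul1r; apply/andP; split.
      by apply: g_nonincreasing => //; lra.
    have xyx : x - y <= x by lra.
    have slope := g_slope _ _ xy0 xyx.
    have g4 : g ((x - y) / 2) <= C * g x.
      apply: (@le_trans _ _ (g (4^-1 * x))); last by near: x.
      by apply: g_nonincreasing => //; lra.
    have k1 : (x - (x - y)) / (x - y) * 2 <= 4 * y / x.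
      rewrite opprB addrCA subrr addr0 mulrAC ler_pdivrMr// mulrAC ler_pdivlMr//.
      by nra.
    have k2 : g (x - y) - g x <= 4 * y / x * (C * g x).
      apply: (le_trans slope); apply: ler_pM => //; last by rewrite ltW// g0//; lra.
      by rewrite mulr_ge0// divr_ge0//; lra.
    move: k2; generalize (g (x - y)) (g x) => a b k2.
    have -> : (1 + 4 * y * C / x) * b = b + 4 * y / x * (C * b) by field; lra.
    lra.
  + exact: cvg_cst.
  + rewrite -[X in _ --> X]addr0; apply: cvgD; first exact: cvg_cst.
    rewrite -[X in _ --> X](mulr0 (4 * y * C)); apply: cvgMr.
    rewrite gtr0_cvgV0; first exact: cvg_id.
    by near=> x; near: x; exact: nbhs_pinfty_gt.
Unshelve. all: by end_near. Qed.

Section integrated_tail_class.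
Variables (R : realType) (d : nat) (A : set 'rV[R]_d).
Hypothesis A_ruin : @ruin_sets R d A.
Variable c : 'rV[R]_d.
Hypothesis c_gt0 : forall j, 0 < c ord0 j.
Variables (disp : measure_display) (T : measurableType disp)
  (P : probability T R) (X : {RV P >-> Rd R d}).
Hypothesis X_ge0 : {ae P, forall w, orthant (X w)}.
Hypothesis EX_fin : forall j : 'I_d, ('E_P[coordinate X j] < +oo)%E.
Hypothesis Theta_fin : (0 < Theta (distribution P X) c < +oo)%E.

Local Notation g := (ruin_mass A c X).
Let theta : R := fine (Theta (distribution P X) c).

Let theta_gt0 : 0 < theta.
Proof. exact: fine_gt0. Qed.

Let G (x : R) : R := Num.min 1 (g x / theta).

Let G_law : exists V : probability R R, V `]-oo, 0[%classic = 0%E /\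
  forall x : R, 0 < x -> V `]x, +oo[%classic = (G x)%:E.
Proof.
apply: law_of_tail.
- move=> x x0; rewrite le_min ler01 ge_min lexx/= andbT.
  by rewrite divr_ge0 ?ruin_mass_ge0// ltW.
- move=> x y x0 xy; rewrite le_min !ge_min lexx/=.
  by rewrite ler_pM2r ?invr_gt0// ruin_mass_nonincreasing// orbT.
- move=> x x0; apply: cvg_min1; apply: cvgMl; exact: ruin_mass_right_continuous.
- have h : g x / theta @[x --> +oo] --> 0 * theta^-1.
    by apply: cvgMl; exact: ruin_mass_cvg0.
  rewrite mul0r in h.
  by have := cvg_min1 _ h; rewrite min_r//; apply.
Qed.

Lemma integrated_tailE (x : R) : 0 < x ->
  integrated_tail (distribution P X) c (scale_set x A) = (g x / theta)%:E.
Proof.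
move=> x0; rewrite /integrated_tail integral_translate_ruin_region//.
by rewrite ruin_massE// -EFinM mulrC.
Qed.

Theorem integrated_tail_class_at V :
  radial_law (distribution P X) A V -> dominatedly_varying V ->
  class_at (@dominatedly_varying R `&` @long_tailed R) A
    (integrated_tail (distribution P X) c).
Proof.
move=> V_law V_D; have [W [W0 WG]] := G_law.
have tW (x : R) : 0 < x -> tail W x = G x.
  by move=> x0; rewrite /tail WG.
have g0 (x : R) : 0 < x -> 0 < g x by exact: ruin_mass_gt0 V_law V_D _.
have W_gt0 (x : R) : 0 < x -> 0 < tail W x.
  by move=> x0; rewrite tW// lt_min ltr01 divr_gt0// g0.
have gW : \forall x \near +oo, tail W x = g x / theta.
  have := ruin_mass_cvg0 A_ruin c_gt0 X_ge0 EX_fin.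
  move=> /cvgr0Pnorm_le /(_ _ theta_gt0) gn.
  near=> x; have x0 : 0 < x by near: x; exact: nbhs_pinfty_gt.
  rewrite tW// /G min_r// ler_pdivrMr// mul1r.
  by apply: (le_trans (ler_norm _)); near: x.
exists W.
  split => // x x0; rewrite WG// integrated_tailE//.
  by rewrite -EFin_min.
apply: (@dominatedly_varying_long_tailed_of_slope _ _ _ _ theta_gt0 W_gt0 gW g0).
- by move=> x y; exact: ruin_mass_nonincreasing.
- by move=> x y; exact: ruin_mass_slope.
- by move=> b; exact: ruin_mass_dominated V_law V_D _.
Unshelve. all: by end_near. Qed.

End integrated_tail_class.

(** * A subexponential law on the diagonal *)

Section diagonal_law.
Variables (R : realType) (d : nat).
Hypothesis d_gt0 : (0 < d)%N.
Local Notation T := (@lognormal_tail R).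

Lemma lognormal_law (a : R) : 0 < a -> exists V : probability R R,
  V `]-oo, 0[%classic = 0%E /\
  forall x : R, 0 < x -> V `]x, +oo[%classic = (T (a * x))%:E.
Proof.
move=> a0; apply: (@law_of_tail R (fun x => T (a * x))).
- by move=> x x0; apply: lognormal_tail01; rewrite mulr_ge0// ltW.
- move=> x y x0 xy; apply: lognormal_tail_nonincreasing.
    by rewrite mulr_ge0// ltW.
  by rewrite ler_pM2l.
- move=> x x0; apply: cvg_at_right_filter.
  apply: (@cvg_comp _ _ _ (fun y => a * y) T _ (nbhs (a * x))).
    by apply: cvgMr; exact: cvg_id.
  by apply: lognormal_tail_continuous; rewrite mulr_gt0.
- exact: (cvg_comp _ _ (cvg_pinfty_mull a0) (@lognormal_tail_cvg0 R)).
Qed.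

Lemma subexponential_lognormal_law (V : probability R R) (a : R) : 0 < a ->
  V `]-oo, 0[%classic = 0%E ->
  (forall x : R, 0 < x -> V `]x, +oo[%classic = (T (a * x))%:E) ->
  subexponential V.
Proof.
move=> a0 V0 VT.
have tV : \forall x \near +oo, tail V x = T (a * x).
  by near=> x; rewrite /tail VT//; near: x; exact: nbhs_pinfty_gt.
apply: subexponential_of_big_jump => //.
- by move=> x x0; rewrite /tail VT//= lognormal_tail_gt0.
- exact: (long_tail_scale a0 tV (@lognormal_tail_long R)).
- exact: (big_jump_tail_scale a0 tV (@lognormal_tail_big_jump R)).
Unshelve. all: by end_near. Qed.

Lemma const_mx_continuous : continuous (fun r : R => const_mx r : 'rV[R]_d).
Proof.
move=> r B /nbhs_ballP[f /= f0 fB]; apply/nbhs_ballP; exists f => //= q rq.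
by apply: fB; split => // i j; rewrite !mxE.
Qed.

(** [A] is open and increasing, so that it meets the diagonal in an open ray;
    the ray starts above 0 because [A] avoids a box around 0. *)
Lemma ruin_set_diagonal (A : set 'rV[R]_d) : ruin_sets A ->
  exists2 u : R, 0 < u & forall s : R, A (const_mx s) <-> u < s.
Proof.
move=> A_ruin; have [e e0 eA] := ruin_set_box A_ruin.
pose S := [set s : R | A (const_mx s)].
have Se s : S s -> e <= s.
  by move=> /eA[j]; rewrite mxE => /ltW.
have S0 : S !=set0.
  have [|t t0 At] := @ruin_set_absorbs _ _ _ A_ruin (const_mx 1).
    by move=> j; rewrite mxE.
  by rewrite scalemx_const mulr1 in At; exists t.
have lS : has_lbound S by exists e.
exists (inf S); first by apply: (lt_le_trans e0); exact: lb_le_inf.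
move=> s; split => [As|].
  have Ss : S s by [].
  have : \forall r \near s, S r.
    case: A_ruin => _ _ oA _ _.
    exact: (@const_mx_continuous s A (open_nbhs_nbhs (conj oA As))).
  move=> /nbhs_ballP[f /= f0 fS].
  have Sf : S (s - f / 2).
    by apply: fS; rewrite /ball/= opprB addrC subrK gtr0_norm; lra.
  apply: (@le_lt_trans _ _ (s - f / 2)); first exact: ge_inf.
  lra.
move=> /(inf_lt S0)[r Ar rs].
by apply: (ruin_set_upward A_ruin Ar) => j; rewrite !mxE ltW.
Qed.

Definition diagonal (z : R) : Rd R d := const_mx z.

Lemma measurable_diagonal : measurable_fun setT diagonal.
Proof.
apply: (@measurability _ _ _ _ setT diagonal (@open 'rV[R]_d)) => // _ [B oB <-].
rewrite setTI; apply: open_measurable.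
apply: (@open_comp _ _ (fun r : R => const_mx r : 'rV[R]_d)) => // z _.
exact: const_mx_continuous.
Qed.

HB.instance Definition _ :=
  isMeasurableFun.Build _ _ _ _ diagonal measurable_diagonal.

Variable V : probability R R.
Hypothesis V_ge0 : V `]-oo, 0[%classic = 0%E.
Hypothesis V_tail : forall x : R, 0 < x -> V `]x, +oo[%classic = (T x)%:E.

Lemma diagonal_law_orthant : distribution V diagonal (@orthant R d) = 1%E.
Proof.
rewrite /distribution /= /pushforward.
have -> : diagonal @^-1` (@orthant R d) = `[0, +oo[%classic.
  apply/seteqP; split => z /=; rewrite in_itv/= andbT.
    by move=> /(_ (Ordinal d_gt0)); rewrite mxE.
  by move=> z0 j; rewrite mxE.
exact: nonneg_law_ge0.
Qed.

Lemma diagonal_lawE (A : set 'rV[R]_d) (u x : R) : 0 < u ->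
  (forall s : R, A (const_mx s) <-> u < s) -> 0 < x ->
  distribution V diagonal (scale_set x A) = (T (u * x))%:E.
Proof.
move=> u0 Au x0; rewrite -V_tail ?mulr_gt0// scale_ruin_setE//.
rewrite /distribution /= /pushforward; congr (V _).
apply/seteqP; split => z /=; rewrite in_itv/= andbT /diagonal scalemx_const.
  by move/Au; rewrite mulrC ltr_pdivlMr.
by move=> uz; apply/Au; rewrite mulrC ltr_pdivlMr.
Qed.

Lemma halfspace_ruin_set : 
  ruin_sets [set z : 'rV[R]_d | 1 < z ord0 (Ordinal d_gt0)].
Proof.
set j := Ordinal d_gt0; split.
- by exists (const_mx 2); rewrite /= mxE; lra.
- split => // /(_ 0 I)/=; rewrite mxE; lra.
- apply: (@open_comp _ _ (fun z : 'rV[R]_d => z ord0 j) [set y | 1 < y]).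
    by move=> z _; exact: coord_continuous.
  exact: open_gt.
- move=> x y /= x1 /(_ j) y0; rewrite mxE; lra.
split.
  move=> x y t; rewrite !inE/= => x1 y1; apply/negP; rewrite -leNgt !mxE/=.
  move/negP : x1; move/negP : y1; rewrite -!leNgt.
  have [t0 t1] : 0 <= t%:num /\ t%:num <= 1 by split.
  by rewrite (_ : unstable.onem _ = 1 - t%:num)//; nra.
move=> /(_ (ball 0 1) (nbhsx_ballx _ _ ltr01)) [z [/= z1 [_ /(_ ord0 j)]]].
rewrite mxE /ball/= sub0r normrN => /(le_lt_trans (ler_norm _)); lra.
Qed.

Lemma diagonal_law_subexponential :
  distr_class (@subexponential R) (distribution V diagonal).
Proof.
split; first exact: diagonal_law_orthant.
move=> A A_ruin; have [u u0 Au] := ruin_set_diagonal A_ruin.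
have [W [W0 WT]] := lognormal_law u0.
exists W; last exact: subexponential_lognormal_law WT.
split => // x x0; rewrite WT// [X in Order.min _ X](diagonal_lawE u0 Au x0) min_r// lee_fin.
by have /andP[] := @lognormal_tail01 R (u * x) (ltW (mulr_gt0 u0 x0)).
Qed.

Lemma diagonal_law_not_dominatedly_varying (B : set (probability R R)) :
  ~ distr_class (@dominatedly_varying R `&` B) (distribution V diagonal).
Proof.
move=> [_ /(_ _ halfspace_ruin_set)[W [W0 WF] [[W_gt0 WD] _]]].
have [u u0 Au] := ruin_set_diagonal halfspace_ruin_set.
have WT (x : R) : 0 < x -> tail W x = T (u * x).
  move=> x0; rewrite /tail WF// [X in Order.min _ X](diagonal_lawE u0 Au x0) min_r// lee_fin.
  by have /andP[] := @lognormal_tail01 R (u * x) (ltW (mulr_gt0 u0 x0)).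
have half : 0 < (2^-1 : R) < 1 by lra.
have [C WC] := (near_tail_ratio_bounded _ W_gt0).1 (WD _ half).
apply: (@lognormal_tail_half_unbounded R C).
have ui : 0 < u^-1 by rewrite invr_gt0.
have {}WC : \forall x \near +oo, tail W (2^-1 * (u^-1 * x)) <= C * tail W (u^-1 * x).
  exact: (cvg_pinfty_mull ui WC).
near=> x.
have x0 : 0 < x by near: x; exact: nbhs_pinfty_gt.
have un : u != 0 by rewrite gt_eqF.
have -> : 2^-1 * x = u * (2^-1 * (u^-1 * x)) by field.
rewrite -[in leRHS](mulVKf un x) -!WT ?mulr_gt0//.
by near: x.
Unshelve. all: by end_near. Qed.

End diagonal_law.

Theorem proposition4p1 (R : realType) (d : nat) (d_gt0 : (0 < d)%N)
    (disp : measure_display) (T : measurableType disp) (P : probability T R)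
    (X : {RV P >-> Rd R d}) (theta : {RV P >-> R}) (p : 'rV[R]_d)
    (X_ge0 : {ae P, forall w, orthant (X w)})
    (EX_fin : forall j : 'I_d, ('E_P[coordinate X j] < +oo)%E)
    (theta_ge0 : {ae P, forall w, 0 <= theta w})
    (Etheta_fin : ('E_P[theta] < +oo)%E)
    (p_gt0 : forall j, 0 < p ord0 j)
    (F_DL : distr_class (@dominatedly_varying R `&` @long_tailed R)
      (distribution P X))
    (c_gt0 : forall j, 0 < net_drift P X theta p ord0 j)
    (Theta_fin : (0 < Theta (distribution P X) (net_drift P X theta p)
                  < +oo)%E) :
  class_ruin (@dominatedly_varying R `&` @long_tailed R)
    (integrated_tail (distribution P X) (net_drift P X theta p)) /\
  @distr_class R d (@dominatedly_varying R `&` @long_tailed R) `<`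
    @distr_class R d (@subexponential R).
Proof.
split.
  move=> A A_ruin; have [V V_law [V_D _]] := F_DL.2 A A_ruin.
  exact: integrated_tail_class_at V_law V_D.
split.
  move=> F [F1 FDL]; split => // A A_ruin.
  have [V V_law [V_D V_L]] := FDL A A_ruin.
  exists V => //.
  exact: dominatedly_varying_long_tailed_subexponential V_law.1 V_D V_L.
have [V [V0 VT]] := @lognormal_law R 1 ltr01.
have {}VT (x : R) : 0 < x -> V `]x, +oo[%classic = (lognormal_tail x)%:E.
  by move=> x0; rewrite VT// mul1r.
move=> /(_ _ (diagonal_law_subexponential d_gt0 V0 VT)).
exact: diagonal_law_not_dominatedly_varying.
Qed.
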